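(* Fix $T\in(0,\infty)$ and $\sigma\in(0,1)$, and let assumptions (i) and (ii) of the context hold. Given $(\boldsymbol\zeta,\psi)\in\mathcal C_T$ with $I_T(\boldsymbol\zeta,\psi)<\infty$, there exists $\boldsymbol\varphi^*\in\mathcal S_T(\boldsymbol\zeta,\psi)$ such that (a) $\sum_{k=0}^\infty\int_{[0,T]\times[0,1]}\ell(\varphi^*_k(s,y))\,ds\,dy\le I_T(\boldsymbol\zeta,\psi)+\sigma$; (b) if $(\tilde{\boldsymbol\zeta},\tilde\psi)$ is another pair in $\mathcal C_T$ such that $\boldsymbol\varphi^*\in\mathcal S_T(\tilde{\boldsymbol\zeta},\tilde\psi)$, then $(\tilde{\boldsymbol\zeta},\tilde\psi)=(\boldsymbol\zeta,\psi)$.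
   Context: **Assumptions.** For each $n\in\mathbb N$, $\{d^{(n)}_i\}_{i\in[n]}$ is a sequence of positive integers with even sum and $n_k=|\{i\in[n]:d^{(n)}_i=k\}|$. (i) There is a probability distribution $\boldsymbol p=\{p_k\}_{k\in\mathbb N}$ on $\mathbb N=\{1,2,\dots\}$ with $n_k/n\to p_k$ for every $k$; (ii) there is $\varepsilon_{\boldsymbol p}\in(0,\infty)$ with $\sup_{n}\sum_{k=1}^\infty \frac{n_k}{n}k^{1+\varepsilon_{\boldsymbol p}}<\infty$. **Notation.** $\mathbb N_0=\mathbb N\cup\{0\}$; $\mathbb R_+=[0,\infty)$; $\mathbb R^\infty$ is the space of real sequences with the product topology; $\mathcal C=\mathbb C([0,T]:\mathbb R)$, $\mathcal C_\infty=\mathbb C([0,T]:\mathbb R^\infty)$. Elements of $\mathcal C_\infty$ are written $\boldsymbol\zeta=(\zeta_k)_{k\in\mathbb N_0}$. For $\boldsymbol x=(x_0,x_1,\dots)\in\mathbb R\times\mathbb R_+^\infty$: $r(\boldsymbol x)=(x_0)^++\sum_{k=1}^\infty kx_k$, $r_0(\boldsymbol x)=\frac{(x_0)^+}{r(\boldsymbol x)}1_{\{r(\boldsymbol x)>0\}}$, $r_k(\boldsymbol x)=\frac{kx_k}{r(\boldsymbol x)}1_{\{r(\boldsymbol x)>0\}}$ for $k\in\mathbb N$, where $x^+=\max\{x,0\}$. $\Gamma:\mathcal C\to\mathcal C$ is the Skorokhod map $\Gamma(\psi)(t)=\psi(t)-\inf_{0\le s\le t}(\psi(s)\wedge 0)$.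 $\mathcal C_T$ is the set of $(\boldsymbol\zeta,\psi)\in\mathcal C_\infty\times\mathcal C$ such that: $\psi(0)=0$ and $\psi$ is absolutely continuous on $[0,T]$; $\zeta_0=\Gamma(\psi)$; and for each $k\in\mathbb N$, $\zeta_k(0)=p_k$, $\zeta_k$ is non-increasing, absolutely continuous and nonnegative on $[0,T]$. Let $\ell(x)=x\log x-x+1$ for $x\ge0$ (with $\ell(0)=1$). For $(\boldsymbol\zeta,\psi)\in\mathcal C_T$, $\mathcal S_T(\boldsymbol\zeta,\psi)$ is the set of all $\boldsymbol\varphi=(\varphi_k)_{k\in\mathbb N_0}$ of measurable functions $\varphi_k:[0,T]\times[0,1]\to\mathbb R_+$ such that for all $t\in[0,T]$ $$\psi(t)=\sum_{k=0}^\infty(k-2)\int_{[0,t]\times[0,1]}1_{[0,r_k(\boldsymbol\zeta(s)))}(y)\varphi_k(s,y)\,ds\,dy,$$ $$\zeta_k(t)=p_k-\int_{[0,t]\times[0,1]}1_{[0,r_k(\boldsymbol\zeta(s)))}(y)\varphi_k(s,y)\,ds\,dy,\quad k\in\mathbb N.$$ $I_T(\boldsymbol\zeta,\psi)=\inf_{\boldsymbol\varphi\in\mathcal S_T(\boldsymbol\zeta,\psi)}\sum_{k=0}^\infty\int_{[0,T]\times[0,1]}\ell(\varphi_k(s,y))\,ds\,dy$ for $(\boldsymbol\zeta,\psi)\in\mathcal C_T$ (infimum over the empty set is $\infty$). *)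

(* Defs.v *)
From mathcomp Require Import all_boot all_order all_algebra.
From mathcomp Require Import all_classical all_reals all_analysis.
Import Order.TTheory GRing.Theory Num.Theory.
Import numFieldNormedType.Exports.

Set Implicit Arguments.
Unset Strict Implicit.
Unset Printing Implicit Defensive.

Local Open Scope classical_set_scope.
Local Open Scope ring_scope.

Definition degree_count (d : forall n : nat, 'I_n -> nat) (n k : nat) : nat :=
  #|[set i : 'I_n | d n i == k]%SET|.

(* Distributions on {1, 2, ...}: the value at index 0 is never used. *)
Definition is_distribution (R : realType) (p : nat -> R) : Prop :=
  (forall k, (0 < k)%N -> 0 <= p k) /\
  (\sum_(1 <= k <oo) (p k)%:E = 1)%E.

Definition degree_convergence (R : realType)
    (d : forall n : nat, 'I_n -> nat) (p : nat -> R) : Prop :=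
  forall k, (0 < k)%N ->
    (fun n => (degree_count d n k)%:R / n%:R : R) @ \oo --> p k.

Definition degree_moment (R : realType)
    (d : forall n : nat, 'I_n -> nat) (eps : R) : \bar R :=
  ereal_sup [set (\sum_(1 <= k <oo)
      ((degree_count d n k)%:R / n%:R * k%:R `^ (1 + eps))%:E)%E
    | n in [set n | (0 < n)%N]].

(* The total weight may be +oo, in which case [rfrac] vanishes, as x / +oo = 0
   in \bar R. *)
Definition rtot (R : realType) (x : nat -> R) : \bar R :=
  ((Num.max (x 0%N) 0)%:E + \sum_(1 <= k <oo) (k%:R * x k)%:E)%E.

Definition rfrac (R : realType) (x : nat -> R) (k : nat) : R :=
  if (0 < rtot x)%E then
    fine ((if k is 0%N then Num.max (x 0%N) 0 else k%:R * x k)%:E / rtot x)%E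
  else 0.

Definition skorokhod (R : realType) (psi : R -> R) (t : R) : R :=
  psi t - inf [set Num.min (psi s) 0 | s in `[0, t]].

Definition abs_continuous (R : realType) (a b : R) (f : R -> R) : Prop :=
  forall e : R, 0 < e -> exists2 delta : R, 0 < delta &
    forall (n : nat) (u v : 'I_n -> R),
      (forall i, a <= u i /\ u i <= v i /\ v i <= b) ->
      trivIset setT (fun i => `]u i, v i[%classic) ->
      \sum_(i < n) (v i - u i) < delta ->
      \sum_(i < n) `|f (v i) - f (u i)| < e.

(* Paths on [0, T] are total functions on R of which only the values on [0, T]
   matter; [zeta t k] is the k-th coordinate at time t. *)
Record in_CT (R : realType) (T : R) (p : nat -> R)
    (zeta : R -> nat -> R) (psi : R -> R) : Prop := InCT {
  CT_zeta_cont :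
    {within `[0, T], continuous (zeta : R -> {ptws nat -> R})};
  CT_psi_cont : {within `[0, T], continuous psi};
  CT_psi0 : psi 0 = 0;
  CT_psi_ac : abs_continuous 0 T psi;
  CT_zeta0 : forall t : R, 0 <= t <= T -> zeta t 0%N = skorokhod psi t;
  CT_init : forall k, (0 < k)%N -> zeta 0 k = p k;
  CT_noninc : forall k, (0 < k)%N ->
    forall s t : R, 0 <= s -> s <= t -> t <= T -> zeta t k <= zeta s k;
  CT_ac : forall k, (0 < k)%N -> abs_continuous 0 T (zeta ^~ k);
  CT_ge0 : forall k, (0 < k)%N -> forall t : R, 0 <= t <= T -> 0 <= zeta t k }.

Definition strip (R : realType) (t : R) : set (R * R) :=
  `[0, t] `*` `[0, 1].

(* ell 0 = 1 since ln 0 = 0. *)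
Definition ell (R : realType) (x : R) : R := x * ln x - x + 1.

Definition thinned_mass (R : realType) (zeta : R -> nat -> R)
    (phi : nat -> R * R -> R) (k : nat) (t : R) : \bar R :=
  (\int[@lebesgue_measure R \x @lebesgue_measure R]_(u in strip t)
    (\1_(`[0%R, rfrac (zeta u.1) k[ : set R) u.2 * phi k u)%:E)%E.

(* In the equation for psi only the terms k = 0, 1 can be negative, so the
   series always has a limit in \bar R. Since -oo + +oo = -oo there, the
   series is real only if all the masses with k <> 2 are finite; for k = 2
   finiteness follows from the equation for zeta. *)
Record ST (R : realType) (T : R) (p : nat -> R)
    (zeta : R -> nat -> R) (psi : R -> R)
    (phi : nat -> R * R -> R) : Prop := InST {
  ST_meas : forall k, measurable_fun (strip T) (phi k);
  ST_ge0 : forall (k : nat) (u : R * R), strip T u -> 0 <= phi k u;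
  ST_psi : forall t : R, 0 <= t <= T ->
    ((psi t)%:E = \sum_(0 <= k <oo)
       ((k%:R - 2)%:E * thinned_mass zeta phi k t))%E;
  ST_zeta : forall t : R, 0 <= t <= T -> forall k, (0 < k)%N ->
    ((zeta t k)%:E = (p k)%:E - thinned_mass zeta phi k t)%E }.

Definition cost (R : realType) (T : R) (phi : nat -> R * R -> R) : \bar R :=
  (\sum_(0 <= k <oo)
     \int[@lebesgue_measure R \x @lebesgue_measure R]_(u in strip T)
       (ell (phi k u))%:E)%E.

Definition IT (R : realType) (T : R) (p : nat -> R)
    (zeta : R -> nat -> R) (psi : R -> R) : \bar R :=
  ereal_inf [set cost T phi | phi in ST T p zeta psi].

(* Main.v *)
Require Import Defs.
From HB Require Import structures.
From mathcomp Require Import all_boot all_order all_algebra.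
From mathcomp Require Import all_classical all_reals all_analysis.
From mathcomp Require Import measurable_realfun.
From mathcomp Require Import ring lra.
Import Order.TTheory GRing.Theory Num.Theory.
Import numFieldNormedType.Exports.

Set Implicit Arguments.
Unset Strict Implicit.
Unset Printing Implicit Defensive.

Local Open Scope classical_set_scope.
Local Open Scope ring_scope.

Local Notation leb2 R := (@lebesgue_measure R \x @lebesgue_measure R)%E.

(** Take a control [phi] whose cost is nearly optimal.  It enters the equations
    only through its integrals over [0 <= y < r_k(zeta s)], so what it does near
    the moving boundary [y = r_k(zeta s)] may be changed.  For [b > 1] slightly
    larger than [1], squeeze [phi k] from [0 <= y < r_k] into [0 <= y < r_k / b]
    and multiply it by [b]; put the value [0] on the gap [r_k / b <= y < b r_k]
    and the value [1], whose cost is [0], above.  All integrals over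
    [0 <= y < r_k] are unchanged ([dilate_gap_mass]), so the new control drives
    the same [(zeta, psi)].  By [ell (b x) / b <= ell x + x ln b] and
    [sum_k r_k <= 1] its cost is at most [b] times the old cost plus a multiple
    of [(b - 1) T] ([gapped_cost]), hence within [sigma] of the infimum once [b]
    is close to [1].

    The gap forces uniqueness.  Let [(zeta', psi')] be driven by the new control
    too, and let [R], [R'] be the total weights of the two states.  The mass
    that leaves coordinate [k] is the integral of the control over
    [0 <= y < r_k], which is nondecreasing in [r_k] and constant for [r_k]
    inside the gap.  Hence, as long as [R / R'] lies in [[1/b, b]], a coordinate
    [zeta' k] that is above [zeta k] loses mass at least as fast as [zeta k]
    ([thinned_le_of_ge]), and one that is below loses it at most as fast
    ([thinned_le_of_le]): the distance between the two cannot grow, for all [k]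
    at once and with no bound uniform in [k].  Coordinate [0] follows in the
    same way, because the Skorokhod reflection only helps the lower path
    ([zero_le_of_thinned_le]).  Thus two solutions that agree at a time [t]
    agree as long as [R / R'] stays in [[1/b, b]].  If [R > 0] at time [t], this
    holds for some time, since total weights are continuous; the moment
    assumption gives this continuity, through [sum_k k p_k < oo].  If [R = 0] at
    time [t], then every coordinate is [0] and stays so ([absorbed_at_zero]).  A
    continuous induction on time concludes ([solution_unique]). *)

(** * The cost function [ell] *)

Lemma ell_ge0 (R : realType) (x : R) : 0 <= x -> 0 <= ell x.
Proof.
rewrite le_eqVlt => /orP[/eqP<-|x0]; first by rewrite /ell mul0r subr0 add0r.
have := @le_ln1Dx R (x^-1 - 1).
rewrite ltrBrDl subrr invr_gt0 x0 addrC subrK lnV// => /(_ isT) h.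
have : x * (1 - x^-1) <= x * ln x by rewrite ler_pM2l//; lra.
by rewrite mulrBr mulr1 mulfV ?gt_eqF// /ell; lra.
Qed.

(** The tangent to [x ln x] at [e]: integrability of [ell phi] bounds the mass
    of [phi]. *)
Lemma le_ellD (R : realType) (x : R) : 0 <= x -> x <= ell x + expR 1.
Proof.
rewrite le_eqVlt => /orP[/eqP<-|x0].
  by rewrite addr_ge0 ?ell_ge0 ?expR_ge0.
have e0 := expR_gt0 (1 : R).
have := @le_ln1Dx R (expR 1 * x^-1 - 1).
rewrite ltrBrDl subrr mulr_gt0 ?invr_gt0// addrC subrK.
rewrite lnM ?posrE ?invr_gt0// lnV// expRK => /(_ isT) h.
have : x * (2 - expR 1 * x^-1) <= x * ln x by rewrite ler_pM2l//; lra.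
rewrite mulrBr mulrCA mulfV ?gt_eqF// /ell; lra.
Qed.

(** Squeezing a control by the factor [b = 1 + delta] and multiplying it by [b]
    turns [ell x] into [ell (b x) / b = ell x + x ln b + 1 / b - 1]. *)
Lemma ell_dilation (R : realType) (delta x : R) : 0 <= delta -> 0 <= x ->
  (1 + delta)^-1 * ell ((1 + delta) * x) <=
  (1 + delta) * ell x + delta * expR 1.
Proof.
move=> d0 x0; have b0 : 0 < 1 + delta by lra.
have hx := le_ellD x0.
have -> : (1 + delta)^-1 * ell ((1 + delta) * x) =
    x * ln ((1 + delta) * x) - x + (1 + delta)^-1.
  by rewrite /ell; field; lra.
have binv : (1 + delta)^-1 <= 1 by rewrite invf_le1//; lra.
have -> : x * ln ((1 + delta) * x) = x * ln (1 + delta) + x * ln x.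
  have [->|xn0] := eqVneq x 0; first by rewrite !mul0r addr0.
  by rewrite lnM ?posrE// ?lt0r ?xn0// mulrDr.
have hl : x * ln (1 + delta) <= delta * x.
  by rewrite mulrC ler_wpM2r// le_ln1Dx//; lra.
have hd : delta * x <= delta * (ell x + expR 1) by rewrite ler_wpM2l.
rewrite {1}/ell in hx *; move: hd; rewrite mulrDr mulrDl mul1r {2}/ell; lra.
Qed.

Lemma measurable_ell (R : realType) : measurable_fun setT (@ell R).
Proof.
apply: measurable_funD => //; apply: measurable_funB => //.
by apply: measurable_funM => //; exact: measurable_ln.
Qed.

Lemma cost_ge0 (R : realType) (T : R) (phi : nat -> R * R -> R) :
  (forall k u, strip T u -> 0 <= phi k u) -> (0 <= cost T phi)%E.
Proof.
move=> phi0; apply: nneseries_ge0 => k _ _; apply: integral_ge0 => u uT.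
by rewrite lee_fin ell_ge0// phi0.
Qed.

(** * Dilations of Lebesgue measure and areas between graphs *)

(** Both sides are measures that agree on the intervals [`]x, y]]. *)
Lemma lebesgue_measure_dilation (R : realType) (b : {posnum R}) (A : set R) :
  measurable A ->
  pushforward (mscale (NngNum (ge0 b)) (@lebesgue_measure R))
    (( *%R b%:num) : R -> measurableTypeR R) A = lebesgue_measure A.
Proof.
move=> mA; apply/esym/lebesgue_measure_unique => //=.
move=> _ [[x y]] _ <-.
rewrite /pushforward /mscale/=.
have -> : *%R b%:num @^-1` `]x, y] = `]x / b%:num, y / b%:num]%classic.
  by apply/seteqP; split => z /=; rewrite !in_itv/= ltr_pdivrMr//
    ler_pdivlMr// mulrC.
rewrite !lebesgue_measure_itv/= !lte_fin ltr_pM2r ?invr_gt0//.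
case: ifP => _; last by rewrite mule0.
by rewrite -EFinD -EFinM; congr EFin; field.
Qed.

Lemma ge0_integral_dilation (R : realType) (b : R) (g : R -> \bar R) : 0 < b ->
  measurable_fun setT g -> (forall y, 0 <= g y)%E ->
  (b%:E * \int[@lebesgue_measure R]_y g (b * y)%R =
   \int[@lebesgue_measure R]_y g y)%E.
Proof.
move=> b0 mg g0; pose bb := PosNum b0.
have mb : measurable_fun [set: R] (( *%R b) : R -> measurableTypeR R).
  exact: measurable_funM.
pose f : R -> measurableTypeR R := *%R b.
have mgf : measurable_fun setT (g \o f) by exact: measurableT_comp mg mb.
transitivity
    (\int[mscale (NngNum (ge0 bb)) (@lebesgue_measure R)]_y (g \o f) y)%E.
  by rewrite ge0_integral_mscale//=.
rewrite -[X in (\int[_]_(_ in X) _)%E = _](preimage_setT f).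
rewrite -ge0_integral_pushforward//.
apply: eq_measure_integral => // A mA _.
exact: (lebesgue_measure_dilation bb).
Qed.

Lemma ge0_integral_dilation2 (R : realType) (b : R) (g : R * R -> \bar R) :
  0 < b -> measurable_fun setT g -> (forall u, 0 <= g u)%E ->
  (b%:E * \int[leb2 R]_u
     g (u.1, b * u.2)%R =
   \int[leb2 R]_u g u)%E.
Proof.
move=> b0 mg g0.
have mgb : measurable_fun setT (fun u : R * R => g (u.1, b * u.2)).
  apply: (measurableT_comp mg); apply: measurable_fun_pair => //.
  exact: measurable_funM.
rewrite !fubini_tonelli1// /fubini_F/= -ge0_integralZl//.
- apply: eq_integral => x _.
  apply: (@ge0_integral_dilation _ _ (fun y => g (x, y))) => //.
  exact: measurableT_comp.
- have := @measurable_fun_fubini_tonelli_F _ _ _ _ R (@lebesgue_measure R)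
    (fun u => g (u.1, b * u.2)).
  by apply.
- by move=> x _; exact: integral_ge0.
- by rewrite lee_fin ltW.
Qed.

Lemma measurable_between_graphs (R : realType) (alpha beta : R -> R) :
  measurable_fun setT alpha -> measurable_fun setT beta ->
  measurable_fun setT (fun u : R * R => \1_`[alpha u.1, beta u.1[ u.2 : R).
Proof.
move=> ma mb.
rewrite [X in measurable_fun _ X](_ : _ = fun u =>
   if (alpha u.1 <= u.2) && (u.2 < beta u.1) then 1 else 0); last first.
  by apply/funext => u; rewrite indicE mem_setE in_itv/=; case: ifP.
apply: measurable_fun_ifT => //; apply: measurable_and.
  by apply: measurable_fun_ler => //; exact: measurableT_comp.
by apply: measurable_fun_ltr => //; exact: measurableT_comp.
Qed.

Lemma integral_between_graphs (R : realType) (T : R) (alpha beta : R -> R) :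
  measurable_fun setT alpha -> measurable_fun setT beta ->
  (forall s, alpha s <= beta s) ->
  (\int[leb2 R]_u
     (\1_`[0%R, T] u.1 * \1_`[alpha u.1, beta u.1[ u.2)%R%:E =
   \int[@lebesgue_measure R]_(s in `[0%R, T]) (beta s - alpha s)%:E)%E.
Proof.
move=> ma mb ab.
have mI := measurable_between_graphs ma mb.
rewrite fubini_tonelli1//; first last.
- apply/measurable_EFinP; apply: measurable_funM => //.
  exact: measurableT_comp.
rewrite [RHS]integral_mkcond; apply: eq_integral => s _.
rewrite /fubini_F/=.
under eq_integral do rewrite EFinM.
rewrite ge0_integralZl//; first last.
- by apply/measurable_EFinP; exact: measurable_indic.
rewrite integral_indic//= setIT lebesgue_measure_itv/= lte_fin.
rewrite patchE indicE; case: (s \in _) => /=; last by rewrite mul0e.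
rewrite mul1e; case: ltgtP (ab s) => // ->; by rewrite subrr.
Qed.

(** * Rescaling a control below a graph and erasing it around the graph *)

Lemma in_strip (R : realType) (t : R) (u : R * R) :
  (u \in strip t) = [&& 0 <= u.1, u.1 <= t, 0 <= u.2 & u.2 <= 1].
Proof. by rewrite /strip in_setX !mem_setE !in_itv/= -andbA. Qed.

Lemma indic_itvco (R : realType) (x y z : R) :
  (\1_`[x, y[ z : R) = (x <= z < y)%R%:R.
Proof. by rewrite indicE mem_setE in_itv. Qed.

Lemma indic_itvcc (R : realType) (x y z : R) :
  (\1_`[x, y] z : R) = (x <= z <= y)%R%:R.
Proof. by rewrite indicE mem_setE in_itv. Qed.

Lemma measurable_strip (R : realType) (t : R) : measurable (@strip R t).
Proof. exact: measurableX. Qed.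

Lemma strip_sub (R : realType) (s t : R) : s <= t -> strip s `<=` strip t.
Proof.
move=> st u [/=]; rewrite /strip/= !in_itv/= => /andP[-> us] ->.
by rewrite (le_trans us).
Qed.

(** The first branch has the same integral over [0 <= y < r / b] as [f] over
    [0 <= y < r]; the second branch is the gap; the value [1] of the last one is
    the zero of [ell]. *)
Definition dilate_gap (R : realType) (b : R) (r : R -> R) (f : R * R -> R)
    (u : R * R) : R :=
  if u.2 < r u.1 / b then b * f (u.1, b * u.2)
  else if u.2 < b * r u.1 then 0 else 1.

Lemma measurable_dilate_gap (R : realType) (b : R) (r : R -> R)
    (f : R * R -> R) : measurable_fun setT r -> measurable_fun setT f ->
  measurable_fun setT (dilate_gap b r f).
Proof.
move=> mr mf.
have mr1 : measurable_fun setT (fun u : R * R => r u.1).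
  exact: measurableT_comp.
apply: measurable_fun_ifT.
- by apply: measurable_fun_ltr => //; exact: measurable_funM.
- apply: measurable_funM => //; apply: (measurableT_comp mf).
  by apply: measurable_fun_pair => //; exact: measurable_funM.
- apply: measurable_fun_ifT => //.
  by apply: measurable_fun_ltr => //; exact: measurable_funM.
Qed.

Lemma dilate_gap_ge0 (R : realType) (b : R) (r : R -> R) (f : R * R -> R) u :
  0 <= b -> (forall u, 0 <= f u) -> 0 <= dilate_gap b r f u.
Proof.
move=> b0 f0; rewrite /dilate_gap; case: ifP => // _; last by case: ifP.
by rewrite mulr_ge0.
Qed.

(** The integrands correspond under the dilation of the second variable, because
    the part [r / b <= y < r] of the domain lies in the gap. *)
Lemma dilate_gap_mass (R : realType) (b t : R) (r : R -> R) (f : R * R -> R) :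
  1 <= b -> measurable_fun setT r -> (forall s, 0 <= r s <= 1) ->
  measurable_fun setT f -> (forall u, 0 <= f u) ->
  (\int[leb2 R]_(u in strip t)
     (\1_`[0%R, r u.1[ u.2 * dilate_gap b r f u)%R%:E =
   \int[leb2 R]_(u in strip t)
     (\1_`[0%R, r u.1[ u.2 * f u)%R%:E)%E.
Proof.
move=> b1 mr r01 mf f0; have b0 : 0 < b by exact: lt_le_trans b1.
pose G (u : R * R) : \bar R :=
  (\1_`[0%R, t] u.1 * (\1_`[0%R, r u.1[ u.2 * f u))%R%:E.
have mG : measurable_fun setT G.
  apply/measurable_EFinP; apply: measurable_funM; first exact: measurableT_comp.
  apply: measurable_funM => //.
  exact: (@measurable_between_graphs _ (fun=> 0)).
have G0 u : (0 <= G u)%E by rewrite lee_fin !mulr_ge0.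
rewrite [RHS]integral_mkcond; transitivity
    (\int[leb2 R]_u G u)%E; last first.
  apply: eq_integral => u _; rewrite patchE in_strip /G indic_itvcc indic_itvco.
  have /andP[_ r1] := r01 u.1.
  case: ifPn => [/and4P[-> -> -> _]/=|]; first by rewrite mul1r.
  case: (0 <= u.1 <= t) / andP => [[-> ->]|]/=; last by rewrite mul0r.
  by case: (0 <= u.2 < r u.1) / andP => [[-> /ltW u2]|];
    rewrite ?mul0r ?mulr0// (le_trans u2).
rewrite -(@ge0_integral_dilation2 _ b)// -ge0_integralZl//; last 2 first.
- apply: (measurableT_comp mG); apply: measurable_fun_pair => //.
  exact: measurable_funM.
- by rewrite lee_fin ltW.
rewrite [LHS]integral_mkcond; apply: eq_integral => u _.
rewrite patchE in_strip /G/= -EFinM indic_itvcc !indic_itvco /dilate_gap.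
have /andP[r0 r1] := r01 u.1.
rewrite pmulr_rge0// ltr_pdivlMr// [u.2 * b]mulrC.
have [u2b|u2b] := ltP (b * u.2) (r u.1); last first.
  rewrite andbF mul0r !mulr0; case: ifPn => // /and4P[_ _ u20 _].
  rewrite u20/=; case: ltP => // u2r; rewrite ?mul0r// ifT ?mulr0//.
  by rewrite (lt_le_trans u2r)// ler_peMl.
have [u10|] := boolP (0 <= u.1); last by rewrite !mul0r mulr0.
have [u1t|] := boolP (u.1 <= t); last by rewrite !mul0r mulr0.
have [u20|] := boolP (0 <= u.2); last by rewrite !mul0r !mulr0.
have u2r : u.2 < r u.1 by rewrite (le_lt_trans _ u2b)// ler_peMl.
by rewrite (le_trans (ltW u2r))//= u2r !mul1r.
Qed.

(** The part below the graph is handled by [ell_dilation] after undoing the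
    dilation; the gap has height [b r - r / b <= 2 delta r] and unit cost. *)
Lemma dilate_gap_cost (R : realType) (delta T : R) (r : R -> R)
    (f : R * R -> R) :
  0 < delta -> measurable_fun setT r -> (forall s, 0 <= r s <= 1) ->
  measurable_fun setT f -> (forall u, 0 <= f u) ->
  (\int[leb2 R]_(u in strip T)
     (ell (dilate_gap (1 + delta) r f u))%:E <=
   (1 + delta)%:E *
     \int[leb2 R]_(u in strip T)
       (ell (f u))%:E +
   (delta * (expR 1 + 2))%:E *
     \int[@lebesgue_measure R]_(s in `[0%R, T]) (r s)%:E)%E.
Proof.
move=> d0 mr r01 mf f0; set b := 1 + delta.
have b1 : 1 <= b by rewrite /b; lra.
have b0 : 0 < b by exact: lt_le_trans b1.
have mr1 : measurable_fun setT (fun u : R * R => r u.1).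
  exact: measurableT_comp.
have mI : measurable_fun setT (fun u : R * R => \1_`[0, T] u.1 : R).
  exact: measurableT_comp.
pose H (u : R * R) : \bar R := (\1_`[0%R, T] u.1 *
  (\1_`[0%R, r u.1[ u.2 * (b^-1 * ell (b * f u))))%R%:E.
have mH : measurable_fun setT H.
  apply/measurable_EFinP; apply: measurable_funM => //.
  apply: measurable_funM; first exact: (@measurable_between_graphs _ (fun=> 0)).
  apply: measurable_funM => //.
  by apply: measurableT_comp; [exact: measurable_ell|exact: measurable_funM].
have H0 u : (0 <= H u)%E.
  by rewrite lee_fin !mulr_ge0 ?invr_ge0 ?ell_ge0 ?mulr_ge0 ?(ltW b0).
pose Z1 (u : R * R) : \bar R := (\1_`[0%R, T] u.1 * \1_`[0%R, r u.1[ u.2)%R%:E.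
pose Z2 (u : R * R) : \bar R :=
  (\1_`[0%R, T] u.1 * \1_`[(r u.1 / b)%R, (b * r u.1)%R[ u.2)%R%:E.
have mrb : measurable_fun setT (fun s => r s / b) by exact: measurable_funM.
have mbr : measurable_fun setT (fun s => b * r s) by exact: measurable_funM.
have mZ1 : measurable_fun setT Z1.
  apply/measurable_EFinP; apply: measurable_funM => //.
  exact: (@measurable_between_graphs _ (fun=> 0)).
have mZ2 : measurable_fun setT Z2.
  apply/measurable_EFinP; apply: measurable_funM => //.
  exact: (measurable_between_graphs mrb mbr).
have Z10 u : (0 <= Z1 u)%E by rewrite lee_fin mulr_ge0.
have Z20 u : (0 <= Z2 u)%E by rewrite lee_fin mulr_ge0.
have mL : measurable_fun (strip T) (fun u => (ell (f u))%:E).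
  apply/measurable_EFinP; apply: measurable_funTS.
  by apply: measurableT_comp => //; exact: measurable_ell.
pose L := (fun u => (ell (f u))%:E) \_ (strip T).
have mLT : measurable_fun setT L.
  by apply/(measurable_restrictT _ _).1 => //; exact: measurable_strip.
have L0 u : (0 <= L u)%E.
  by rewrite /L patchE; case: ifP => // _; rewrite lee_fin ell_ge0.
have mHb : measurable_fun setT (fun u : R * R => H (u.1, b * u.2)).
  apply: (measurableT_comp mH); apply: measurable_fun_pair => //.
  exact: measurable_funM.
have mbH : measurable_fun setT (fun u : R * R => b%:E * H (u.1, b * u.2)%R)%E.
  exact: measurable_funeM.
have bH0 u : (0 <= b%:E * H (u.1, b * u.2)%R)%E.
  by rewrite mule_ge0// lee_fin ltW.
(* [H (s, b y)], multiplied by [b], is the cost density where [b y < r s], and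
   [Z2] is that of the gap. *)
have step1 : (\int[leb2 R]_(u in strip T)
     (ell (dilate_gap b r f u))%:E <=
   \int[leb2 R]_u
      (b%:E * H (u.1, b * u.2)%R + Z2 u))%E.
  rewrite [leLHS]integral_mkcond; apply: ge0_le_integral => //.
  - move=> u _; rewrite patchE; case: ifP => // _.
    by rewrite lee_fin ell_ge0// dilate_gap_ge0// ltW.
  - apply/(measurable_restrictT _ _).1; first exact: measurable_strip.
    apply/measurable_EFinP; apply: measurable_funTS; apply: measurableT_comp.
      exact: measurable_ell.
    exact: measurable_dilate_gap.
  - exact: emeasurable_funD.
  move=> u _; rewrite patchE in_strip.
  case: ifPn => [|_]; last by rewrite adde_ge0.
  move=> /and4P[u10 u1T u20 u21].
  rewrite /H /Z2/= -EFinM -EFinD lee_fin !indic_itvcc !indic_itvco u10 u1T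
    !mul1r.
  rewrite /dilate_gap pmulr_rge0// u20 /= ltr_pdivlMr// [u.2 * b]mulrC.
  have [u2b|u2b] := ltP (b * u.2) (r u.1).
    by rewrite mul1r mulrA mulfV ?gt_eqF// mul1r lerDl.
  rewrite mul0r mulr0 add0r ler_pdivrMr// [u.2 * b]mulrC u2b/=.
  by case: ifP => _; rewrite /ell /= ?mul0r ?mul1r ?ln1; lra.
have step2 : (\int[leb2 R]_u H u <=
   \int[leb2 R]_u
      (b%:E * L u + (delta * expR 1)%:E * Z1 u))%E.
  apply: ge0_le_integral => //.
    by apply: emeasurable_funD; exact: measurable_funeM.
  move=> u _; rewrite /L patchE in_strip /H /Z1 !indic_itvcc !indic_itvco.
  have [u10|_] := boolP (0 <= u.1); last by rewrite !mul0r mule0 add0e mule0.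
  have [u1T|_] := boolP (u.1 <= T); last by rewrite !mul0r mule0 add0e mule0.
  have [u20|_] := boolP (0 <= u.2); last first.
    by rewrite !mul0r !mulr0 mule0 add0e mule0.
  have [u2r|_] := boolP (u.2 < r u.1); last first.
    rewrite !mul0r !mulr0 mule0 adde0; case: ifP => _; rewrite ?mule0//.
    by rewrite -EFinM lee_fin mulr_ge0 ?ell_ge0// ltW.
  rewrite (le_trans (ltW u2r)) ?(andP (r01 _)).2//= !mul1r.
  by rewrite -!EFinM -EFinD lee_fin mulr1 ell_dilation// ltW.
have iZ1 : (\int[leb2 R]_u Z1 u =
    \int[@lebesgue_measure R]_(s in `[0%R, T]) (r s)%:E)%E.
  rewrite (@integral_between_graphs _ T (fun=> 0) r)//.
    by apply: eq_integral => s _; rewrite subr0.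
  by move=> s; case/andP: (r01 s).
have r0 s : 0 <= r s by case/andP: (r01 s).
have iZ2 : (\int[leb2 R]_u Z2 u <=
    (delta * 2)%:E * \int[@lebesgue_measure R]_(s in `[0%R, T]) (r s)%:E)%E.
  have binv : 1 - delta <= b^-1.
    rewrite -[leRHS]mul1r ler_pdivlMr// /b.
    by have := sqr_ge0 delta; rewrite expr2; lra.
  have h s : 0 <= b * r s - r s / b <= delta * 2 * r s.
    have -> : b * r s - r s / b = (b - b^-1) * r s by ring.
    have binv1 : b^-1 <= 1 by rewrite invf_le1.
    rewrite mulr_ge0 ?subr_ge0 ?(le_trans binv1)//=.
    by apply: ler_wpM2r => //; move: binv; rewrite /b; lra.
  have mD : measurable_fun (`[0%R, T]%classic : set R) r.
    exact: measurable_funTS.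
  rewrite (integral_between_graphs T mrb mbr)//; last first.
    by move=> s; case/andP: (h s); rewrite subr_ge0.
  rewrite -ge0_integralZl//; last 3 first.
  - exact/measurable_EFinP.
  - by move=> s _; rewrite lee_fin.
  - by rewrite lee_fin mulr_ge0// ltW.
  apply: ge0_le_integral => //.
  - by move=> s _; rewrite lee_fin; case/andP: (h s).
  - by apply/measurable_EFinP; apply: measurable_funB; exact: measurable_funTS.
  - by apply: measurable_funeM; exact/measurable_EFinP.
  - by move=> s _; rewrite -EFinM lee_fin; case/andP: (h s).
apply: (le_trans step1); rewrite ge0_integralD// ge0_integralZl//; last first.
  by rewrite lee_fin ltW.
rewrite ge0_integral_dilation2//.
have e1 : 0 <= delta * expR 1 by rewrite mulr_ge0 ?expR_ge0// ltW.
have e2 : 0 <= delta * 2 by rewrite mulr_ge0// ltW.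
have -> : (delta * (expR 1 + 2))%:E = ((delta * expR 1)%:E + (delta * 2)%:E)%E.
  by rewrite -EFinD mulrDr.
rewrite [X in (_ <= _ + X)%E]ge0_muleDl ?lee_fin//.
rewrite [leRHS]addeA; apply: leeD; last by [].
apply: (le_trans step2); rewrite ge0_integralD//; first last.
- exact: measurable_funeM.
- by move=> u _; rewrite mule_ge0.
- exact: measurable_funeM.
- by move=> u _; rewrite mule_ge0// lee_fin ltW.
rewrite !ge0_integralZl// ?lee_fin ?(ltW b0)//.
by rewrite iZ1 /L -integral_mkcond.
Qed.

(** * Total weight of a state *)

Definition weight (R : realType) (x : nat -> R) (k : nat) : R :=
  if k is 0%N then Num.max (x 0%N) 0 else k%:R * x k.

Definition total (R : realType) (x : nat -> R) : R := fine (rtot x).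

(** The states for which [rtot] is a real number, so that [rfrac] is an honest
    quotient. *)
Definition finite_mean (R : realType) (x : nat -> R) : Prop :=
  (forall k, (0 < k)%N -> 0 <= x k) /\
  (\sum_(1 <= k <oo) (k%:R * x k)%:E < +oo)%E.

Section state.
Variables (R : realType) (x : nat -> R).
Hypothesis fm : finite_mean x.

Lemma weight_ge0 k : 0 <= weight x k.
Proof.
case: fm => x0 _; case: k => [|k]/=; first by rewrite le_max lexx orbT.
by rewrite mulr_ge0// x0.
Qed.

Lemma rtot_sum_weight : rtot x = (\sum_(0 <= k <oo) (weight x k)%:E)%E.
Proof.
rewrite nneseries_recl//; last by move=> k _; rewrite lee_fin weight_ge0.
congr (_ + _)%E; rewrite eseries_cond [RHS]eseries_cond.
by apply: eq_eseriesr => -[|k].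
Qed.

Lemma rtotE : rtot x = (total x)%:E.
Proof.
rewrite fineK// ge0_fin_numE ?rtot_sum_weight.
  rewrite -rtot_sum_weight /rtot lte_add_pinfty// ?ltry//.
  by case: fm.
by apply: nneseries_ge0 => k _ _; rewrite lee_fin weight_ge0.
Qed.

Lemma sum_weight : (\sum_(0 <= k <oo) (weight x k)%:E = (total x)%:E)%E.
Proof. by rewrite -rtot_sum_weight rtotE. Qed.

Lemma total_ge0 : 0 <= total x.
Proof.
rewrite -lee_fin -sum_weight.
by apply: nneseries_ge0 => k _ _; rewrite lee_fin weight_ge0.
Qed.

Lemma weight_le_total k : weight x k <= total x.
Proof.
rewrite -lee_fin -sum_weight.
apply: (le_trans _ (nneseries_lim_ge k.+1 _)); last first.
  by move=> n _ _; rewrite lee_fin weight_ge0.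
rewrite big_nat_recr//= leeDr// sume_ge0// => i _.
by rewrite lee_fin weight_ge0.
Qed.

Lemma rfracE k : rfrac x k = weight x k / total x.
Proof.
rewrite /rfrac rtotE lte_fin; case: ltP => t0; last first.
  by rewrite (@le_anti _ _ (total x) 0) ?t0 ?total_ge0// invr0 mulr0.
rewrite (_ : (if k is 0%N then _ else _) = weight x k); last by case: k.
by rewrite inver// gt_eqF.
Qed.

Lemma rfrac_itv k : 0 <= rfrac x k <= 1.
Proof.
rewrite rfracE; have := total_ge0; rewrite le_eqVlt => /orP[/eqP<-|t0].
  by rewrite invr0 mulr0 lexx ler01.
rewrite divr_ge0 ?weight_ge0 ?(ltW t0)//=.
by rewrite ler_pdivrMr// mul1r weight_le_total.
Qed.

Lemma sum_rfrac_le1 : (\sum_(0 <= k <oo) (rfrac x k)%:E <= 1)%E.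
Proof.
under eq_eseriesr do rewrite rfracE mulrC EFinM.
rewrite nneseriesZl; last by move=> k _; rewrite lee_fin weight_ge0.
rewrite sum_weight -EFinM lee_fin; have [->|t0] := eqVneq (total x) 0.
  by rewrite mulr0.
by rewrite mulVf.
Qed.

End state.

Lemma finite_mean_le (R : realType) (x p : nat -> R) :
  (forall k, (0 < k)%N -> 0 <= x k <= p k) -> finite_mean p -> finite_mean x.
Proof.
move=> xp [_ pf]; split=> [k k0|]; first by case/andP: (xp k k0).
apply: le_lt_trans pf; apply: lee_nneseries => [[//|k] _ _|[|k] _].
- by rewrite lee_fin mulr_ge0//; case/andP: (xp k.+1 isT).
- by rewrite !mul0r.
- by rewrite lee_fin ler_wpM2l//; case/andP: (xp k.+1 isT).
Qed.

Lemma weight_le (R : realType) (x y : nat -> R) k :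
  x k <= y k -> weight x k <= weight y k.
Proof.
case: k => [|k] xy /=; last by rewrite ler_wpM2l.
by rewrite ge_max !le_max xy lexx orbT.
Qed.

Lemma total_eq0 (R : realType) (x : nat -> R) : finite_mean x ->
  0 <= x 0%N -> total x = 0 -> forall k, x k = 0.
Proof.
move=> fm x0 tot0 k; have := weight_le_total fm k.
rewrite tot0; case: k => [|k] /= w0.
  by apply/eqP; rewrite eq_le x0 andbT (le_trans _ w0)// le_max lexx.
apply/eqP; rewrite eq_le; case: fm => /(_ k.+1 isT) -> _; rewrite andbT.
by move: w0; rewrite pmulr_rle0.
Qed.

(** Fatou's lemma for series: the finite sums of [k p_k] are limits of those of
    [k n_k / n], which are bounded by the moment of order [1 + eps]. *)
Lemma finite_mean_limit (R : realType) (d : forall n : nat, 'I_n -> nat)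
    (p : nat -> R) (eps : R) :
  0 < eps -> (degree_moment d eps < +oo)%E -> degree_convergence d p ->
  is_distribution p -> finite_mean p.
Proof.
move=> eps0 mfin dp [p0 _]; split => //.
pose c n k : R := (degree_count d n k)%:R / n%:R.
have c0 n k : 0 <= c n k by rewrite divr_ge0.
suff : (\sum_(1 <= k <oo) (k%:R * p k)%:E <= degree_moment d eps)%E.
  by move/le_lt_trans; apply.
have p0' k : (1 <= k)%N -> true -> (0 <= (k%:R * p k)%:E)%E.
  by move=> k1 _; rewrite lee_fin mulr_ge0// p0.
apply: lime_le; first exact: is_cvg_nneseries.
apply: nearW => K.
have partial n : (0 < n)%N ->
    ((\sum_(1 <= k < K) k%:R * c n k)%:E <= degree_moment d eps)%E.
  move=> n0; apply: le_trans; last first.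
    by apply: ereal_sup_ubound; exists n => //; exact: n0.
  apply: le_trans (nneseries_lim_ge K _); last first.
    by move=> k _ _; rewrite lee_fin mulr_ge0 ?powR_ge0// divr_ge0.
  rewrite -sumEFin big_nat [leRHS]big_nat; apply: lee_sum => k /andP[k1 _].
  by rewrite lee_fin mulrC ler_wpM2l// le1r_powR ?ler1n// lerDl ltW.
have cK : (fun n => \sum_(1 <= k < K) k%:R * c n k) @ \oo -->
    \sum_(1 <= k < K) k%:R * p k.
  rewrite !big_nat; under eq_fun do rewrite big_nat.
  apply: (@cvg_big _ _ +%R); first exact: add_continuous.
  move=> k /andP[k1 _]; apply: cvgMr; exact: dp.
have mE : degree_moment d eps = (fine (degree_moment d eps))%:E.
  rewrite fineK// ge0_fin_numE//; apply: (le_trans _ (partial 1%N isT)).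
  by rewrite lee_fin sumr_ge0// => k _; rewrite mulr_ge0.
rewrite sumEFin mE lee_fin; apply: (cvgr_to_le cK).
exists 1%N => // n /= n0; rewrite -lee_fin -mE; exact: partial.
Qed.

(** * Regularity of the paths *)

Section path.
Variables (R : realType) (T : R) (p : nat -> R).
Variables (zeta : R -> nat -> R) (psi : R -> R).
Hypothesis CT : in_CT T p zeta psi.
Hypothesis fmp : finite_mean p.

Lemma path_itv k t : (0 < k)%N -> 0 <= t <= T -> 0 <= zeta t k <= p k.
Proof.
move=> k0 tT; rewrite (CT_ge0 CT)//= -(CT_init CT k0).
by case/andP: tT => t0 tT; rewrite (CT_noninc CT).
Qed.

Lemma path_finite_mean t : 0 <= t <= T -> finite_mean (zeta t).
Proof.
by move=> tT; apply: finite_mean_le fmp => k k0; exact: path_itv.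
Qed.

Lemma path_coord_continuous k :
  {within `[0, T], continuous (fun t => zeta t k)}.
Proof.
apply/subspace_continuousP => t tT.
have /subspace_continuousP/(_ t tT) := CT_zeta_cont CT.
by move/pointwise_cvgP => /(_ k).
Qed.

Lemma path_weight_continuous k :
  {within `[0, T], continuous (fun t => weight (zeta t) k)}.
Proof.
apply/subspace_continuousP => t tT.
have /subspace_continuousP/(_ t tT) := @path_coord_continuous k.
case: k => [|k] h /=; last exact: cvgMr.
apply: (cvg_comp _ (fun y => Num.max y 0) h).
by apply: (@continuous_max _ _ id (cst 0)); [exact: cvg_id|exact: cvg_cst].
Qed.

(** As [zeta t k <= p k], the series of the total weight is dominated by that of
    [k p_k], hence converges uniformly in time. *)
Lemma path_total_continuous :
  {within `[0, T], continuous (fun t => total (zeta t))}.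
Proof.
apply/subspace_continuousP => t tT; apply/cvgrPdist_lt => e e0.
have e40 : 0 < e / 4 by rewrite divr_gt0.
have c0 k : (0 <= (k%:R * p k)%:E)%E.
  case: k => [|k]; first by rewrite mul0r.
  by rewrite lee_fin mulr_ge0//; case: fmp => + _; apply.
have tail : (\sum_(N <= k <oo) (k%:R * p k)%:E @[N --> \oo] --> 0)%E.
  apply: nneseries_tail_cvg => //.
  by rewrite nneseries_recl// mul0r add0e; case: fmp.
have e40E : (0 < (e / 4)%:E)%E by rewrite lte_fin.
have [N _ hN] := tail _ (open_ereal_lt' e40E).
have tailN := hN N.+1 (leqnSn N).
pose S s := \sum_(0 <= k < N.+1) weight (zeta s) k.
have approx s : 0 <= s <= T -> S s <= total (zeta s) < S s + e / 4.
  move=> sT; have fms := path_finite_mean sT.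
  rewrite -lee_fin -lte_fin -sum_weight// (nneseries_split 0 N.+1); last first.
    by move=> k _; rewrite lee_fin weight_ge0.
  rewrite add0n sumEFin EFinD leeDl ?lteD2lE//=; last first.
    by apply: nneseries_ge0 => k _ _; rewrite lee_fin weight_ge0.
  apply: le_lt_trans tailN; rewrite eseries_cond [leRHS]eseries_cond.
  apply: lee_nneseries => [k _ _|[|k] //= _].
    by rewrite lee_fin weight_ge0.
  by rewrite lee_fin ler_wpM2l//; case/andP: (path_itv (isT : 0 < k.+1)%N sT).
have tT' : 0 <= t <= T by move: tT; rewrite /= in_itv.
have cS : S s @[s --> within `[0, T] (nbhs t)] --> S t.
  apply: (@cvg_big _ _ +%R); first exact: add_continuous.
  move=> k _.
  exact: (subspace_continuousP _ _).1 (@path_weight_continuous k) t tT.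
near=> s; rewrite /from_subspace.
have sT : 0 <= s <= T.
  suff : s \in `[0, T] by rewrite in_itv.
  by near: s; exact: withinT.
have : `|S t - S s| < e / 4.
  by near: s; move/cvgrPdist_lt : cS; apply.
case/andP: (approx s sT) (approx t tT') => s1 s2 /andP[t1 t2].
by rewrite !ltr_norml => /andP[? ?]; apply/andP; split; lra.
Unshelve. all: by end_near. Qed.

Lemma path_rfrac_measurable k :
  measurable_fun (`[0, T]%classic : set R) (fun t => rfrac (zeta t) k).
Proof.
have mw := subspace_continuous_measurable_fun (measurable_itv _)
  (@path_weight_continuous k).
have mt := subspace_continuous_measurable_fun (measurable_itv _)
  path_total_continuous.
(* The power [-1] is measurable on the whole line and agrees with the inverse on
   nonnegative reals. *)
apply: (eq_measurable_fun
  (fun t => weight (zeta t) k * (total (zeta t) `^ (-1)))).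
  move=> t; rewrite inE/= in_itv/= => tT; have fmt := path_finite_mean tT.
  by rewrite rfracE// powR_inv1// total_ge0.
apply: measurable_funM; first exact: mw.
exact: (measurableT_comp (@measurable_powR R (-1)) mt).
Qed.
End path.

(** * Continuous functions on a compact interval *)

Lemma within_itv_dist_lt (R : realType) (a b : R) (f : R -> R) :
  {within `[a, b], continuous f} ->
  forall x, a <= x <= b -> forall e, 0 < e -> exists2 delta, 0 < delta &
    forall y, a <= y <= b -> `|y - x| < delta -> `|f y - f x| < e.
Proof.
move=> /subspace_continuousP cf x xab e e0.
have /cf /cvgrPdist_lt /(_ e e0) : `[a, b]%classic x by rewrite /= in_itv.
rewrite near_withinE => -[delta /= delta0 hd]; exists delta => // y yab yx.
by rewrite distrC; apply: hd; rewrite /= ?in_itv// distrC.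
Qed.

(** If [f t > 0], look at the last time [s <= t] at which [f <= 0]. *)
Lemma nonpos_of_noninc_while_pos (R : realType) (a c : R) (f : R -> R) :
  {within `[a, c], continuous f} -> f a <= 0 ->
  (forall s t, a <= s -> s <= t -> t <= c ->
     (forall u, s < u <= t -> 0 < f u) -> f t <= f s) ->
  forall t, a <= t <= c -> f t <= 0.
Proof.
move=> cf fa hf t /andP[at_ tc]; rewrite leNgt; apply/negP => ft.
pose B := [set u | a <= u <= t /\ f u <= 0].
have Ba : B a by split => //; rewrite lexx.
have ubB : ubound B t by move=> u [/andP[]].
have supB : has_sup B by split; [exists a|exists t].
have as_ : a <= sup B by exact: ub_le_sup (ex_intro _ t ubB) _ Ba.
have st : sup B <= t by apply: ge_sup => //; exists a.
have fs : f (sup B) <= 0.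
  rewrite leNgt; apply/negP => fs.
  have sac : a <= sup B <= c by rewrite as_ (le_trans st).
  have [delta delta0 hd] := within_itv_dist_lt cf sac fs.
  have [u [/andP[au ut] fu] su] := sup_adherent delta0 supB.
  have us : u <= sup B by apply: ub_le_sup; [exists t|split; rewrite ?au].
  have : `|f u - f (sup B)| < f (sup B).
    apply: hd; first by rewrite au (le_trans ut).
    by rewrite ltr_norml; apply/andP; split; lra.
  by rewrite ltr_norml => /andP[]; lra.
suff : f t <= f (sup B) by lra.
apply: hf => // u /andP[su ut]; rewrite ltNge; apply/negP => fu.
have : u <= sup B.
  by apply: ub_le_sup; [exists t|split; rewrite // ut (le_trans as_)// ltW].
by rewrite leNgt su.
Qed.

Lemma eq0_of_eq0_before (R : realType) (T t : R) (f : R -> R) :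
  {within `[0, T], continuous f} -> 0 < t <= T ->
  (forall s, 0 <= s -> s < t -> f s = 0) -> f t = 0.
Proof.
move=> cf /andP[t0 tT] f0; apply/eqP; rewrite -normr_le0 leNgt.
apply/negP => ft.
have tT' : 0 <= t <= T by rewrite tT ltW.
have [delta delta0 hd] := within_itv_dist_lt cf tT' ft.
pose s := Num.max 0 (t - delta / 2).
have s0 : 0 <= s by rewrite le_max lexx.
have st : s < t by rewrite gt_max t0/=; lra.
have : t - delta / 2 <= s by rewrite le_max lexx orbT.
move=> sd; have := hd s.
rewrite s0 (le_trans (ltW st))// f0// sub0r normrN ltxx.
move=> /(_ isT) h; have /h // : `|s - t| < delta.
by rewrite ltr_norml; apply/andP; split; lra.
Qed.

(** Apply the two hypotheses to the infimum of the times at which [P] fails. *)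
Lemma real_induction (R : realType) (T : R) (P : R -> Prop) :
  (forall t, 0 <= t <= T -> (forall s, 0 <= s -> s < t -> P s) -> P t) ->
  (forall t, 0 <= t -> t < T -> (forall s, 0 <= s <= t -> P s) ->
     exists2 delta, 0 < delta &
       forall s, t <= s < t + delta -> s <= T -> P s) ->
  forall t, 0 <= t <= T -> P t.
Proof.
move=> closed open t tT; apply: contrapT => nPt.
pose B := [set s | 0 <= s <= T /\ ~ P s].
have Bt : B t by [].
have lbB : lbound B 0 by move=> s [/andP[]].
have infB : has_inf B by split; [exists t|exists 0].
have i0 : 0 <= inf B by apply: lb_le_inf => //; exists t.
have it : inf B <= t by apply: ge_inf => //; exists 0.
have iT : inf B <= T by case/andP: tT => _; exact: le_trans.
have below s : 0 <= s -> s < inf B -> P s.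
  move=> s0 si; apply: contrapT => nPs.
  have : inf B <= s.
    apply: ge_inf; first by exists 0.
    by split => //; rewrite s0 ltW// (lt_le_trans si).
  by rewrite leNgt si.
have Pi : P (inf B) by apply: closed => //; rewrite i0.
have iltT : inf B < T.
  rewrite lt_neqAle iT andbT; apply/eqP => iET; apply: nPt.
  have -> // : t = inf B.
  by apply/eqP; rewrite eq_le it iET; case/andP: tT => _ ->.
have [s /andP[s0 si]|delta delta0 hd] := open _ i0 iltT.
  by move: si; rewrite le_eqVlt => /orP[/eqP->//|]; exact: below.
have [s [sT nPs] sd] := inf_adherent delta0 infB.
apply: (nPs); apply: hd; last by case/andP: sT.
by rewrite sd andbT; apply: ge_inf; [exists 0|].
Qed.

(** * The Skorokhod map *)

Section skorokhod.
Variables (R : realType) (T : R) (psi : R -> R).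
Hypothesis cpsi : {within `[0, T], continuous psi}.

Let m t := inf [set Num.min (psi s) 0 | s in `[0, t]].

Let skorokhodE t : skorokhod psi t = psi t - m t. Proof. by []. Qed.

(* The infimum is a minimum, by compactness. *)
Let m_attained t : 0 <= t <= T -> exists2 s, 0 <= s <= t &
  m t = Num.min (psi s) 0 /\
  forall u, 0 <= u <= t -> m t <= Num.min (psi u) 0.
Proof.
move=> /andP[t0 tT].
have cmin : {within `[0, t], continuous (fun s => Num.min (psi s) 0)}.
  have cpsit : {within `[0, t], continuous psi}.
    by apply: continuous_subspaceW cpsi; apply: subset_itvl; rewrite bnd_simp.
  by move=> x; apply: continuous_min; [exact: cpsit|exact: cvg_cst].
have [s s0t hs] := EVT_min t0 cmin.
have lb : lbound [set Num.min (psi s) 0 | s in `[0, t]] (Num.min (psi s) 0).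
  by move=> _ [u /= ut <-]; exact: hs.
have ms : m t = Num.min (psi s) 0.
  apply/eqP; rewrite eq_le; apply/andP; split.
    by apply: ge_inf; [exists (Num.min (psi s) 0)|exists s].
  by apply: lb_le_inf => //; exists (Num.min (psi s) 0), s.
exists s; first by move: s0t; rewrite in_itv.
by split => // u ut; rewrite ms; apply: hs; rewrite in_itv.
Qed.

Let m_le t u : 0 <= u <= t -> t <= T -> m t <= Num.min (psi u) 0.
Proof.
move=> /[dup] ut' /andP[u0 ut] tT.
by have [|s _ [_]] := @m_attained t; [rewrite tT (le_trans u0)|apply].
Qed.

Lemma skorokhod_ge0 t : 0 <= t <= T -> 0 <= skorokhod psi t.
Proof.
move=> /andP[t0 tT]; rewrite skorokhodE subr_ge0.
by rewrite (le_trans (@m_le t t _ tT)) ?t0 ?lexx// ge_min lexx.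
Qed.

Lemma skorokhod_increment_ge s t : 0 <= s <= t -> t <= T ->
  psi t - psi s <= skorokhod psi t - skorokhod psi s.
Proof.
move=> /andP[s0 st] tT; rewrite !skorokhodE.
have [|u /andP[u0 us] [mu _]] := @m_attained s.
  by rewrite s0 (le_trans st).
have := @m_le t u _ tT; rewrite -mu u0 (le_trans us)// => /(_ isT); lra.
Qed.

(** The running minimum cannot decrease while the reflected path is positive. *)
Lemma skorokhod_increment_pos s t : 0 <= s <= t -> t <= T ->
  (forall u, s < u <= t -> 0 < skorokhod psi u) ->
  skorokhod psi t - skorokhod psi s = psi t - psi s.
Proof.
move=> /andP[s0 st] tT pos; rewrite !skorokhodE.
have t0 : 0 <= t by exact: le_trans st.
suff : m s <= m t.
  have [|u /andP[u0 us] [mu _]] := @m_attained s.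
    by rewrite s0 (le_trans st).
  have := @m_le t u _ tT; rewrite -mu u0 (le_trans us)// => /(_ isT); lra.
have [|u /andP[u0 ut] [mu _]] := @m_attained t; first by rewrite t0.
have [us|su] := leP u s; first by rewrite mu m_le ?u0// (le_trans st).
have /pos : s < u <= t by rewrite su.
rewrite skorokhodE subr_gt0 => mu'.
have [psiu|psiu] := leP (psi u) 0.
  have := @m_le u u; rewrite u0 lexx (le_trans ut)// => /(_ isT isT).
  have [|v /andP[v0 vu] [mv _]] := @m_attained u.
    by rewrite u0 (le_trans ut).
  have := @m_le t v _ tT; rewrite v0 (le_trans vu)// => /(_ isT).
  by rewrite -mv mu (min_l psiu); lra.
rewrite mu min_r ?(ltW psiu)//.
rewrite (le_trans (@m_le s s _ _)) ?s0 ?lexx ?(le_trans st)//.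
by rewrite ge_min lexx orbT.
Qed.

(** If the reflected path is at [0] at time [s], then [psi s] is the running
    minimum, and a path that goes down further remains its own minimum. *)
Lemma skorokhod_absorbed s t : 0 <= s <= t -> t <= T ->
  skorokhod psi s <= 0 -> (forall u, s <= u <= t -> psi t <= psi u) ->
  skorokhod psi t = 0.
Proof.
move=> /andP[s0 st] tT; rewrite skorokhodE subr_le0 => sk0 noninc.
have t0 : 0 <= t by exact: le_trans st.
have tt : 0 <= t <= T by rewrite t0.
apply/eqP; rewrite eq_le skorokhod_ge0// andbT skorokhodE subr_le0.
have ts : psi t <= psi s by rewrite noninc// lexx.
have [u /andP[u0 ut] [-> _]] := @m_attained t tt.
have sT := le_trans st tT.
have [us|su] := leP u s.
  by rewrite (le_trans ts)// (le_trans sk0)// m_le// u0.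
rewrite le_min noninc ?(ltW su)//= (le_trans ts)// (le_trans sk0)//.
by rewrite (le_trans (@m_le s s _ _)) ?s0 ?lexx// ge_min lexx orbT.
Qed.

End skorokhod.

Lemma skorokhod0 (R : realType) (psi : R -> R) :
  psi 0 = 0 -> skorokhod psi 0 = 0.
Proof.
by move=> psi0; rewrite /skorokhod set_itv1 image_set1 inf1 psi0 minxx subrr.
Qed.

(** * Masses of a thinned control *)

Section mass.
Variables (R : realType) (T : R) (zeta : R -> nat -> R).
Variables (phi : nat -> R * R -> R) (k : nat).
Hypothesis mr :
  measurable_fun (`[0, T]%classic : set R) (fun t => rfrac (zeta t) k).
Hypothesis mphi : measurable_fun (strip T) (phi k).
Hypothesis phi0 : forall u, strip T u -> 0 <= phi k u.

Definition thinned (u : R * R) : R :=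
  \1_(`[0%R, rfrac (zeta u.1) k[ : set R) u.2 * phi k u.

Lemma thinned_ge0 u : strip T u -> 0 <= thinned u.
Proof. by move=> uT; rewrite mulr_ge0// phi0. Qed.

Lemma measurable_thinned : measurable_fun (strip T) (EFin \o thinned).
Proof.
apply/measurable_EFinP; apply: measurable_funM => //.
pose r := (fun t => rfrac (zeta t) k) \_ `[0, T].
have mrT : measurable_fun setT r.
  by apply/(measurable_restrictT _ _).1.
apply: (eq_measurable_fun (fun u : R * R => \1_`[0, r u.1[ u.2 : R)).
  by move=> u /[!inE] -[/= u1 _]; rewrite /r patchE mem_set.
apply: measurable_funTS.
exact: (@measurable_between_graphs _ (fun=> 0) r).
Qed.

Lemma thinned_mass_ge0 t : t <= T -> (0 <= thinned_mass zeta phi k t)%E.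
Proof.
move=> tT; apply: integral_ge0 => u ut.
by rewrite lee_fin thinned_ge0//; exact: strip_sub ut.
Qed.

(** Finite cost bounds the mass on the whole strip, whatever the path [zeta].
    This includes the mass of index [0], which occurs in no equation for the
    coordinates of [zeta]. *)
Lemma thinned_mass_lt_pinfty t : 0 <= t <= T ->
  (\int[leb2 R]_(u in strip T)
     (ell (phi k u))%:E < +oo)%E ->
  (thinned_mass zeta phi k t < +oo)%E.
Proof.
move=> /andP[t0 tT] fin.
have sT : strip t `<=` @strip R T by exact: strip_sub.
have mL : measurable_fun (strip T) (fun u => (ell (phi k u))%:E).
  apply/measurable_EFinP; exact: (measurableT_comp (@measurable_ell R)).
apply: (@le_lt_trans _ _ (\int[leb2 R]_(u in strip T)
     ((ell (phi k u))%:E + (expR 1)%:E))%E).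
  apply: (@le_trans _ _ (\int[leb2 R]_(u in strip T) (thinned u)%:E)%E).
    apply: ge0_subset_integral => //; try exact: measurable_strip.
    - exact: measurable_thinned.
    - by move=> u uT; rewrite lee_fin thinned_ge0.
  apply: ge0_le_integral => //; first exact: measurable_strip.
  - by move=> u uT; rewrite lee_fin thinned_ge0.
  - exact: measurable_thinned.
  - exact: emeasurable_funD.
  - move=> u uT; rewrite -EFinD lee_fin (le_trans _ (le_ellD (phi0 uT)))//.
    by rewrite /thinned ler_piMl ?phi0// indicE; case: (_ \in _).
rewrite ge0_integralD//; last 2 first.
- exact: measurable_strip.
- by move=> u uT; rewrite lee_fin ell_ge0// phi0.
rewrite lte_add_pinfty// integral_cst; last exact: measurable_strip.
rewrite /strip/= product_measure1E//= !lebesgue_measure_itv/=.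
by do 2 case: ifP => _; rewrite ?(mule0, mul0e) ?ltry//= -?EFinD -?EFinM ltry.
Qed.

Lemma thinned_massD s t : 0 <= s <= t -> t <= T ->
  thinned_mass zeta phi k t = (thinned_mass zeta phi k s +
    \int[leb2 R]_(u in `]s, t] `*` `[0%R, 1%R])
      (thinned u)%:E)%E.
Proof.
move=> /andP[s0 st] tT.
have -> : thinned_mass zeta phi k t =
  (\int[leb2 R]_(u in strip s `|` `]s, t] `*` `[0%R, 1%R])
     (thinned u)%:E)%E.
  congr integral; apply/seteqP; split => u; rewrite /strip/= !in_itv/=.
    by move=> [/andP[u1 u2] u3]; have [us|su] := leP u.1 s;
       [left|right]; rewrite ?u1 ?u2.
  move=> [|] [/andP[u1 u2] u3]; split; rewrite ?u3//.
    by rewrite u1 (le_trans u2).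
  by rewrite u2 andbT (le_trans s0)// ltW.
have sub : strip s `|` `]s, t] `*` `[0%R, 1%R] `<=` strip T.
  move=> u; rewrite /strip/= !in_itv/= => -[|] [/andP[u1 u2] u3]; split;
    rewrite ?u3 ?u1 ?(le_trans u2) ?(le_trans st)//=.
  by rewrite (le_trans s0)// ltW.
rewrite ge0_integral_setU//.
- exact: measurable_strip.
- exact: measurableX.
- by apply: measurable_funS measurable_thinned => //; exact: measurable_strip.
- by move=> u /sub uT; rewrite lee_fin thinned_ge0.
- apply/disj_setPS => u [] /=; rewrite /strip/= !in_itv/=.
  move=> [/andP[_ us] _] [/andP[su _] _].
  by move: (lt_le_trans su us); rewrite ltxx.
Qed.
End mass.

(** With [mass k = p k - x k] for [k > 0], this is
    [sum_(k >= 1) (k - 2) mass k], the nonreflected path without the term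
    [k = 0].  The only negative term [k = 1] is kept outside of the series. *)
Definition drift (R : realType) (p x : nat -> R) : R :=
  fine (\sum_(2 <= k <oo) ((k%:R - 2) * (p k - x k))%:E) - (p 1%N - x 1%N).

Lemma eseries_peel2 (R : realType) (f : nat -> \bar R) :
  f 0%N \is a fin_num -> f 1%N \is a fin_num ->
  (forall k, (1 < k)%N -> 0 <= f k)%E ->
  (\sum_(0 <= k <oo) f k = f 0%N + f 1%N + \sum_(2 <= k <oo) f k)%E.
Proof.
move=> f0 f1 fk.
have cf : (fun n => f 0%N + f 1%N + \sum_(2 <= k < n) f k)%E @ \oo -->
    (f 0%N + f 1%N + \sum_(2 <= k <oo) f k)%E.
  apply: cvgeD; [|exact: cvg_cst|].
    by rewrite fin_num_adde_defr// fin_numD f0.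
  by apply: is_cvg_nneseries => k k2 _; exact: fk.
apply/cvg_lim => //; apply: cvg_trans cf; apply: near_eq_cvg.
exists 2%N => // n /= n2.
by rewrite (big_ltn (ltnW n2 : 0 < n)%N) (big_ltn n2) addeA.
Qed.

(** Sealed, because the conversion test of two masses would otherwise unfold the
    product measure. *)
HB.lock Definition mass (R : realType) (zeta : R -> nat -> R)
    (phi : nat -> R * R -> R) (k : nat) (t : R) : R :=
  fine (thinned_mass zeta phi k t).

Section solution.
Variables (R : realType) (T : R) (p : nat -> R).
Variables (zeta : R -> nat -> R) (psi : R -> R) (phi : nat -> R * R -> R).
Hypothesis CT : in_CT T p zeta psi.
Hypothesis fmp : finite_mean p.
Hypothesis sol : ST T p zeta psi phi.
Hypothesis phi_fin : (cost T phi < +oo)%E.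

Lemma massE k t : 0 <= t <= T ->
  thinned_mass zeta phi k t = (mass zeta phi k t)%:E.
Proof.
move=> /andP[t0 tT].
have mr := path_rfrac_measurable CT fmp k.
rewrite mass.unlock fineK// ge0_fin_numE; last first.
  by apply: thinned_mass_ge0 tT; exact: ST_ge0 sol k.
apply: (@thinned_mass_lt_pinfty _ T) => //;
  [exact: ST_meas sol k|exact: (ST_ge0 sol)|by rewrite t0|].
apply: le_lt_trans phi_fin.
have pos n :
    (0 <= \int[leb2 R]_(u in strip T) (ell (phi n u))%:E)%E.
  by apply: integral_ge0 => u uT; rewrite lee_fin ell_ge0// (ST_ge0 sol).
apply: (le_trans _ (nneseries_lim_ge k.+1 _)) => //.
by rewrite big_nat_recr//= leeDr// sume_ge0.
Qed.

Lemma coord_mass k t : (0 < k)%N -> 0 <= t <= T ->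
  zeta t k = p k - mass zeta phi k t.
Proof.
by move=> k0 tT; apply/EFin_inj; rewrite (ST_zeta sol)// massE.
Qed.

(** Two solutions with the same coordinates of positive index have paths [psi]
    that differ only through [mass 0]. *)
Lemma psi_drift t : 0 <= t <= T ->
  psi t = drift p (zeta t) - 2 * mass zeta phi 0 t.
Proof.
move=> tT; have := ST_psi sol tT.
under eq_eseriesr do rewrite massE// -EFinM.
have m k : (0 < k)%N -> mass zeta phi k t = p k - zeta t k.
  by move=> k0; rewrite coord_mass//; lra.
have k2 k : (1 < k)%N -> 0 <= (k%:R - 2) * mass zeta phi k t.
  move=> k1; rewrite m ?(ltnW k1)// mulr_ge0 ?subr_ge0 ?ler_nat//.
  by have /andP[] := path_itv CT (ltnW k1) tT.
rewrite eseries_peel2//.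
set S := (X in (_ + X)%E).
have SE : S = (\sum_(2 <= k <oo) ((k%:R - 2) * (p k - zeta t k))%:E)%E.
  rewrite /S eseries_cond [RHS]eseries_cond.
  apply: eq_eseriesr => k /andP[_ k1].
  by rewrite (m k (ltnW k1)).
have S0 : (0 <= S)%E.
  by apply: nneseries_ge0 => k k1 _; rewrite lee_fin k2.
rewrite /drift -SE; case: S S0 {SE} => [s|_ //|//] _ /=.
rewrite -!EFinD => -[->]; rewrite (m 1%N)//; lra.
Qed.
End solution.

Section compare.
Variables (R : realType) (T : R) (p : nat -> R) (phi : nat -> R * R -> R).
Hypothesis fmp : finite_mean p.
Hypothesis phi_fin : (cost T phi < +oo)%E.

(** Two solutions driven by the same control are compared through their thinned
    integrands, pointwise. *)
Lemma mass_increment_le (z1 z2 : R -> nat -> R) (psi1 psi2 : R -> R) k s t :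
  in_CT T p z1 psi1 -> ST T p z1 psi1 phi ->
  in_CT T p z2 psi2 -> ST T p z2 psi2 phi ->
  0 <= s <= t -> t <= T ->
  (forall u, s < u.1 <= t -> 0 <= u.2 <= 1 ->
     thinned z1 phi k u <= thinned z2 phi k u) ->
  mass z1 phi k t - mass z1 phi k s <= mass z2 phi k t - mass z2 phi k s.
Proof.
move=> CT1 ST1 CT2 ST2 /andP[s0 st] tT le12.
have sT : 0 <= s <= T by rewrite s0 (le_trans st).
have t0T : 0 <= t <= T by rewrite tT (le_trans s0).
have st' : 0 <= s <= t by rewrite s0.
have mr1 := path_rfrac_measurable CT1 fmp k.
have mr2 := path_rfrac_measurable CT2 fmp k.
have mphi := ST_meas ST1 k; have phi0 := ST_ge0 ST1 k.
have sub : `]s, t] `*` `[0%R, 1%R] `<=` strip T.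
  move=> u; rewrite /strip/= !in_itv/= => -[/andP[su ut] ->]; split => //.
  by rewrite (le_trans s0) ?(ltW su)// (le_trans ut).
have mE1 := massE CT1 fmp ST1 phi_fin k.
have mE2 := massE CT2 fmp ST2 phi_fin k.
have := thinned_massD mr1 mphi phi0 st' tT.
rewrite (mE1 t t0T) (mE1 s sT); set I1 := (X in (_ + X)%E) => h1.
have := thinned_massD mr2 mphi phi0 st' tT.
rewrite (mE2 t t0T) (mE2 s sT); set I2 := (X in (_ + X)%E) => h2.
have : (I1 <= I2)%E.
  apply: ge0_le_integral => //.
  - exact: measurableX.
  - by move=> u /sub uT; rewrite lee_fin (@thinned_ge0 _ T).
  - apply: measurable_funS (measurable_thinned mr1 mphi) => //.
    exact: measurable_strip.
  - apply: measurable_funS (measurable_thinned mr2 mphi) => //.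
    exact: measurable_strip.
  - move=> u [/=]; rewrite !in_itv/= => u1 u2; rewrite lee_fin; exact: le12.
clearbody I1 I2; case: I1 h1 => [i1||] // [->].
by case: I2 h2 => [i2||] // [->]; rewrite lee_fin => ?; lra.
Qed.

End compare.

(** * Comparison of two solutions *)

(** The control vanishes around the graph of every jump rate of [zeta], on a
    range of multiplicative width [b ^ 2]. *)
Definition has_gap (R : realType) (b T : R) (zeta : R -> nat -> R)
    (phi : nat -> R * R -> R) : Prop :=
  forall k u, strip T u ->
    rfrac (zeta u.1) k / b <= u.2 < b * rfrac (zeta u.1) k -> phi k u = 0.

(** In this section [z k] loses at least as much mass as [z' k] whenever it is
    above it, so that it never gets above it.  Each inequality between two
    solutions is an instance, with the roles exchanged for the second one. *)
Section one_sided.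
Variables (R : realType) (T : R) (p : nat -> R) (phi : nat -> R * R -> R).
Variables (z z' : R -> nat -> R) (psi psi' : R -> R).
Hypothesis fmp : finite_mean p.
Hypothesis phi_fin : (cost T phi < +oo)%E.
Hypothesis CTz : in_CT T p z psi.
Hypothesis CTz' : in_CT T p z' psi'.
Hypothesis STz : ST T p z psi phi.
Hypothesis STz' : ST T p z' psi' phi.
Variables (a c : R) (k : nat).
Hypothesis a0 : 0 <= a.
Hypothesis cT : c <= T.
Hypothesis start : z a k = z' a k.
Hypothesis thinned_le : forall u, a <= u.1 <= c -> 0 <= u.2 <= 1 ->
  z' u.1 k <= z u.1 k -> thinned z' phi k u <= thinned z phi k u.

Let inT t : a <= t <= c -> 0 <= t <= T.
Proof. by move=> /andP[at_ tc]; rewrite (le_trans a0)//= (le_trans tc). Qed.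

Let coord_le :
  (forall s r, a <= s <= c -> a <= r <= c -> s <= r ->
     (forall u, s < u <= r -> z' u k < z u k) ->
     mass z' phi k r - mass z' phi k s <= mass z phi k r - mass z phi k s ->
     z r k - z s k <= z' r k - z' s k) ->
  forall t, a <= t <= c -> z t k <= z' t k.
Proof.
move=> step t tac; rewrite -subr_le0.
apply: (@nonpos_of_noninc_while_pos _ a c (fun t => z t k - z' t k)) => //.
- have sub : `[a, c] `<=` `[0, T] by move=> x /=; rewrite !in_itv/=; exact: inT.
  have cz := continuous_subspaceW sub (@path_coord_continuous _ _ _ _ _ CTz k).
  have cz' :=
    continuous_subspaceW sub (@path_coord_continuous _ _ _ _ _ CTz' k).
  by move=> x; apply: continuousB; [exact: cz|exact: cz'].
- by rewrite start subrr.
move=> s r as_ sr rc pos.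
have sac : a <= s <= c by rewrite as_ (le_trans sr).
have rac : a <= r <= c by rewrite rc (le_trans as_).
have lt' u : s < u <= r -> z' u k < z u k by move=> /pos; rewrite subr_gt0.
suff : z r k - z s k <= z' r k - z' s k by lra.
apply: step; [exact: sac|exact: rac|exact: sr|exact: lt'|].
apply: (mass_increment_le fmp phi_fin CTz' STz' CTz STz).
- by rewrite (le_trans a0).
- exact: le_trans cT.
move=> u /[dup] sur /andP[su ur] u2; apply: thinned_le => //.
  by rewrite (le_trans as_) ?(ltW su)//= (le_trans ur).
exact/ltW/lt'.
Qed.

Lemma coord_le_of_thinned_le t : (0 < k)%N -> a <= t <= c -> z t k <= z' t k.
Proof.
move=> k0; apply: coord_le => s r sac rac sr _.
rewrite !(coord_mass CTz fmp STz phi_fin) ?inT//.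
rewrite !(coord_mass CTz' fmp STz' phi_fin) ?inT//; lra.
Qed.

(** When [z 0 > z' 0 >= 0], the path [z] is not reflected, while the reflection
    of [z'] can only push [z' 0] up. *)
Lemma zero_le_of_thinned_le t : k = 0%N ->
  (forall s j, (0 < j)%N -> a <= s <= c -> z s j = z' s j) ->
  a <= t <= c -> z t k <= z' t k.
Proof.
move=> k0 agree; apply: coord_le => s r sac rac sr; rewrite k0 => lt' incr.
have drift_agree x : a <= x <= c -> drift p (z x) = drift p (z' x).
  move=> xac; rewrite /drift agree//; congr (fine _ - _).
  rewrite eseries_cond [RHS]eseries_cond; apply: eq_eseriesr => j /andP[_ j1].
  by rewrite agree// ltnW.
have s0r : 0 <= s <= r by rewrite sr andbT; case/andP: (inT sac).
have rT : r <= T by case/andP: (inT rac).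
have g' := skorokhod_increment_ge (CT_psi_cont CTz') s0r rT.
have g : skorokhod psi r - skorokhod psi s = psi r - psi s.
  apply: (skorokhod_increment_pos (CT_psi_cont CTz)) => // u sur.
  have uT : 0 <= u <= T.
    case/andP: sur => su ur; apply: inT; case/andP: sac => as_ _.
    by rewrite (le_trans as_) ?(ltW su)//= (le_trans ur)//; case/andP: rac.
  rewrite -(CT_zeta0 CTz)//; apply: le_lt_trans (lt' u sur).
  by rewrite (CT_zeta0 CTz')// (skorokhod_ge0 (CT_psi_cont CTz')).
move: g g'; rewrite -!(CT_zeta0 CTz) ?inT// -!(CT_zeta0 CTz') ?inT//.
rewrite !(psi_drift CTz fmp STz phi_fin) ?inT//.
rewrite !(psi_drift CTz' fmp STz' phi_fin) ?inT// !drift_agree//; lra.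
Qed.

End one_sided.

Section comparison.
Variables (R : realType) (b T : R) (p : nat -> R) (phi : nat -> R * R -> R).
Variables (z1 z2 : R -> nat -> R) (psi1 psi2 : R -> R).
Hypothesis b1 : 1 < b.
Hypothesis fmp : finite_mean p.
Hypothesis phi_fin : (cost T phi < +oo)%E.
Hypothesis CT1 : in_CT T p z1 psi1.
Hypothesis CT2 : in_CT T p z2 psi2.
Hypothesis ST1 : ST T p z1 psi1 phi.
Hypothesis ST2 : ST T p z2 psi2 phi.
Hypothesis gap : has_gap b T z1 phi.

Let b0 : 0 < b. Proof. exact: lt_trans b1. Qed.

(** The hypotheses give [r_k (z1) / b <= r_k (z2)], and [phi] vanishes between
    [r_k (z1) / b] and [r_k (z1)]. *)
Lemma thinned_le_of_ge k u : strip T u ->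
  0 < total (z1 u.1) -> 0 < total (z2 u.1) ->
  total (z2 u.1) <= b * total (z1 u.1) -> z1 u.1 k <= z2 u.1 k ->
  thinned z1 phi k u <= thinned z2 phi k u.
Proof.
move=> uT t1 t2 t21 /weight_le w12.
have tT : 0 <= u.1 <= T by move: uT => [+ _]; rewrite /= in_itv.
have fm1 := path_finite_mean CT1 fmp tT.
have fm2 := path_finite_mean CT2 fmp tT.
have u0 : 0 <= u.2 by move: uT => [_]; rewrite /= in_itv/= => /andP[].
have phi0 := ST_ge0 ST1 k uT.
rewrite /thinned !indic_itvco u0/=.
have [ur1|_] := ltP u.2 (rfrac (z1 u.1) k); last first.
  by rewrite mul0r mulr_ge0.
have [r1u|ur1b] := leP (rfrac (z1 u.1) k / b) u.2.
  rewrite (gap uT) ?mulr0// r1u (lt_le_trans ur1)// ler_peMl ?(ltW b1)//.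
  by case/andP: (rfrac_itv fm1 k).
suff -> : u.2 < rfrac (z2 u.1) k by [].
apply: (lt_le_trans ur1b); rewrite !rfracE//.
rewrite -mulrA -invfM ler_pdivrMr ?mulr_gt0//.
rewrite mulrAC ler_pdivlMr// [total (z1 _) * b]mulrC.
by apply: ler_pM => //; [exact: weight_ge0|exact: ltW].
Qed.

(** The hypotheses give [r_k (z2) <= b r_k (z1)], and [phi] vanishes between
    [r_k (z1) / b] and [b r_k (z1)]. *)
Lemma thinned_le_of_le k u : strip T u ->
  0 < total (z1 u.1) -> 0 < total (z2 u.1) ->
  total (z1 u.1) <= b * total (z2 u.1) -> z2 u.1 k <= z1 u.1 k ->
  thinned z2 phi k u <= thinned z1 phi k u.
Proof.
move=> uT t1 t2 t12 /weight_le w21.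
have tT : 0 <= u.1 <= T by move: uT => [+ _]; rewrite /= in_itv.
have fm1 := path_finite_mean CT1 fmp tT.
have fm2 := path_finite_mean CT2 fmp tT.
have u0 : 0 <= u.2 by move: uT => [_]; rewrite /= in_itv/= => /andP[].
have phi0 := ST_ge0 ST1 k uT.
rewrite /thinned !indic_itvco u0/=.
have [ur2|_] := ltP u.2 (rfrac (z2 u.1) k); last first.
  by rewrite mul0r mulr_ge0.
have [r1u|ur1b] := leP (rfrac (z1 u.1) k / b) u.2.
  rewrite (gap uT) ?mulr0// r1u (lt_le_trans ur2)//.
  rewrite !rfracE// ler_pdivrMr// mulrA mulrAC ler_pdivlMr//.
  rewrite [b * _]mulrC -mulrA.
  by apply: ler_pM => //; [exact: weight_ge0|exact: ltW].
suff -> : u.2 < rfrac (z1 u.1) k by [].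
apply: (lt_le_trans ur1b); rewrite ler_pdivrMr// ler_peMr ?(ltW b1)//.
by case/andP: (rfrac_itv fm1 k).
Qed.

Lemma agree_while_totals_close a c : 0 <= a -> c <= T ->
  (forall t, a <= t <= c ->
     [/\ 0 < total (z1 t), 0 < total (z2 t),
         total (z2 t) <= b * total (z1 t)
       & total (z1 t) <= b * total (z2 t)]) ->
  (forall k, z1 a k = z2 a k) ->
  forall t k, a <= t <= c -> z1 t k = z2 t k.
Proof.
move=> a0 cT close start.
have inS u : a <= u.1 <= c -> 0 <= u.2 <= 1 -> strip T u.
  move=> /andP[au uc] u2; split; rewrite /= in_itv//=.
  by rewrite (le_trans a0)//= (le_trans uc).
have le21 k u : a <= u.1 <= c -> 0 <= u.2 <= 1 ->
    z2 u.1 k <= z1 u.1 k -> thinned z2 phi k u <= thinned z1 phi k u.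
  by move=> uac u2; have [? ? ? ?] := close _ uac;
     apply: thinned_le_of_le => //; exact: inS.
have le12 k u : a <= u.1 <= c -> 0 <= u.2 <= 1 ->
    z1 u.1 k <= z2 u.1 k -> thinned z1 phi k u <= thinned z2 phi k u.
  by move=> uac u2; have [? ? ? ?] := close _ uac;
     apply: thinned_le_of_ge => //; exact: inS.
have agree t k : (0 < k)%N -> a <= t <= c -> z1 t k = z2 t k.
  move=> k0 tac; apply/eqP; rewrite eq_le; apply/andP; split.
    exact: (coord_le_of_thinned_le fmp phi_fin CT1 CT2 ST1 ST2
      a0 cT (start k) (le21 k)).
  exact: (coord_le_of_thinned_le fmp phi_fin CT2 CT1 ST2 ST1
    a0 cT (esym (start k)) (le12 k)).
move=> t [|k] tac; last exact: agree.
apply/eqP; rewrite eq_le; apply/andP; split.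
  exact: (zero_le_of_thinned_le fmp phi_fin CT1 CT2 ST1 ST2
    a0 cT (start 0%N) (le21 0%N)).
apply: (zero_le_of_thinned_le fmp phi_fin CT2 CT1 ST2 ST1
  a0 cT (esym (start 0%N)) (le12 0%N)) => //.
by move=> s j j0 sac; rewrite agree.
Qed.

End comparison.

(** * Uniqueness *)

Section absorption.
Variables (R : realType) (T : R) (p : nat -> R) (phi : nat -> R * R -> R).
Variables (zeta : R -> nat -> R) (psi : R -> R).
Hypothesis fmp : finite_mean p.
Hypothesis phi_fin : (cost T phi < +oo)%E.
Hypothesis CT : in_CT T p zeta psi.
Hypothesis sol : ST T p zeta psi phi.

Lemma mass_nondecreasing k s t : 0 <= s <= t -> t <= T ->
  mass zeta phi k s <= mass zeta phi k t.
Proof.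
move=> st tT; have /andP[s0 st'] := st.
have mr := path_rfrac_measurable CT fmp k.
have phi0 := ST_ge0 sol k.
have sT : 0 <= s <= T by rewrite s0 (le_trans st').
have t0T : 0 <= t <= T by rewrite tT (le_trans s0).
have := thinned_massD mr (ST_meas sol k) phi0 st tT.
rewrite !(massE CT fmp sol phi_fin k)//.
set I := (X in (_ + X)%E) => h; rewrite -lee_fin h leeDl//.
apply: integral_ge0 => u [/=]; rewrite !in_itv/= => /andP[su ut] u2.
rewrite lee_fin (@thinned_ge0 _ T)//; split; rewrite /= in_itv//=.
by rewrite (le_trans s0) ?(ltW su)//= (le_trans ut).
Qed.

(** The coordinates of positive index are nonincreasing and nonnegative.  Hence
    only the term [- 2 mass 0] of [psi] still moves after time [a], and [psi] is
    nonincreasing, so the reflected path remains at [0]. *)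
Lemma absorbed_at_zero a : 0 <= a -> (forall k, zeta a k = 0) ->
  forall t k, a <= t <= T -> zeta t k = 0.
Proof.
move=> a0 za t k /andP[at_ tT].
have pos j s : (0 < j)%N -> a <= s <= T -> zeta s j = 0.
  move=> j0 /andP[as_ sT]; apply/eqP; rewrite eq_le.
  rewrite (CT_ge0 CT j0) ?(le_trans a0)// andbT -(za j).
  exact: (CT_noninc CT j0).
case: k => [|k]; last by apply: pos => //; rewrite at_.
rewrite (CT_zeta0 CT) ?(le_trans a0)//.
have a0t : 0 <= a <= t by rewrite a0.
have aT : 0 <= a <= T by rewrite a0 (le_trans at_).
apply: (@skorokhod_absorbed _ _ _ (CT_psi_cont CT) a) => //.
  by rewrite -(CT_zeta0 CT)// za.
move=> u /andP[au ut].
rewrite !(psi_drift CT fmp sol phi_fin) ?tT ?(le_trans a0)//; last first.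
  exact: le_trans tT.
have -> : drift p (zeta t) = drift p (zeta u).
  rewrite /drift !pos ?au ?at_ ?(le_trans ut)//; congr (fine _ - _).
  rewrite eseries_cond [RHS]eseries_cond; apply: eq_eseriesr => j /andP[_ j1].
  by rewrite !pos ?(ltnW j1) ?au ?at_ ?(le_trans ut).
have : mass zeta phi 0 u <= mass zeta phi 0 t.
  by apply: mass_nondecreasing => //; rewrite ut (le_trans a0).
lra.
Qed.

End absorption.

Section uniqueness.
Variables (R : realType) (b T : R) (p : nat -> R) (phi : nat -> R * R -> R).
Variables (z1 z2 : R -> nat -> R) (psi1 psi2 : R -> R).
Hypothesis b1 : 1 < b.
Hypothesis fmp : finite_mean p.
Hypothesis phi_fin : (cost T phi < +oo)%E.
Hypothesis CT1 : in_CT T p z1 psi1.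
Hypothesis CT2 : in_CT T p z2 psi2.
Hypothesis ST1 : ST T p z1 psi1 phi.
Hypothesis ST2 : ST T p z2 psi2 phi.
Hypothesis gap : has_gap b T z1 phi.

Lemma agree_limit t : 0 <= t <= T ->
  (forall s, 0 <= s -> s < t -> forall k, z1 s k = z2 s k) ->
  forall k, z1 t k = z2 t k.
Proof.
move=> /andP[+ tT] before k; rewrite le_eqVlt => /orP[/eqP t0|t0].
  rewrite -t0 in tT *; case: k => [|k].
    by rewrite (CT_zeta0 CT1) ?lexx// (CT_zeta0 CT2) ?lexx// !skorokhod0//;
       [exact: CT_psi0 CT2|exact: CT_psi0 CT1].
  by rewrite (CT_init CT1)// (CT_init CT2).
have c1 := @path_coord_continuous _ _ _ _ _ CT1 k.
have c2 := @path_coord_continuous _ _ _ _ _ CT2 k.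
apply/eqP; rewrite -subr_eq0; apply/eqP.
apply: (@eq0_of_eq0_before _ T t (fun t => z1 t k - z2 t k)).
- by move=> x; apply: continuousB; [exact: c1|exact: c2].
- by rewrite t0.
- by move=> s s0 st; rewrite before// subrr.
Qed.

(** If the common state at time [t] is nonzero, continuity keeps both totals
    within a factor [b] of each other for a while; otherwise both solutions are
    absorbed. *)
Lemma agree_extend t : 0 <= t -> t < T -> (forall k, z1 t k = z2 t k) ->
  exists2 delta, 0 < delta & forall s, t <= s < t + delta -> s <= T ->
    forall k, z1 s k = z2 s k.
Proof.
move=> t0 tT zt; have z12 : z1 t = z2 t by apply/funext.
have tT' : 0 <= t <= T by rewrite t0 ltW.
have fm1 := path_finite_mean CT1 fmp tT'.
have := total_ge0 fm1; rewrite le_eqVlt => /orP[/eqP/esym tot0|tot0].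
  have z10 : forall k, z1 t k = 0.
    apply: total_eq0 => //.
    by rewrite (CT_zeta0 CT1)// (skorokhod_ge0 (CT_psi_cont CT1)).
  exists 1 => // s /andP[ts _] sT k.
  rewrite (absorbed_at_zero fmp phi_fin CT1 ST1 t0) ?ts//.
  by rewrite (absorbed_at_zero fmp phi_fin CT2 ST2 t0) ?ts// -z12.
(* The largest [e] with [total + e <= b (total - e)]. *)
pose e := total (z1 t) * ((b - 1) / (b + 1)).
have b0 : 0 < b by exact: lt_trans b1.
have bp : 0 < b + 1 by rewrite addr_gt0.
have e0 : 0 < e by rewrite mulr_gt0// divr_gt0// subr_gt0.
have eb : e * (b + 1) = total (z1 t) * (b - 1).
  by rewrite /e -mulrA divfK// gt_eqF.
have e_lt : e < total (z1 t).
  by rewrite /e gtr_pMr// ltr_pdivrMr// mul1r ltrD2l -subr_gt0 opprK.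
have cont1 := path_total_continuous CT1 fmp.
have cont2 := path_total_continuous CT2 fmp.
have [d1 d10 h1] := within_itv_dist_lt cont1 tT' e0.
have [d2 d20 h2] := within_itv_dist_lt cont2 tT' e0.
exists (Num.min d1 d2); first by rewrite lt_min d10.
move=> s /andP[ts]; rewrite -ltrBlDl lt_min => /andP[sd1 sd2] sT k.
apply: (agree_while_totals_close b1 fmp phi_fin CT1 CT2 ST1 ST2 gap t0 sT)
  => //; last by rewrite ts lexx.
move=> u /andP[tu us].
have uT : 0 <= u <= T by rewrite (le_trans t0)//= (le_trans us).
have ut : `|u - t| <= s - t by rewrite ger0_norm ?subr_ge0// lerB.
have := h1 u uT (le_lt_trans ut sd1); have := h2 u uT (le_lt_trans ut sd2).
rewrite -z12 !ltr_norml => /andP[l2 r2] /andP[l1 r1].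
have bm1 : b * (total (z1 t) - e) < b * total (z1 u) by rewrite ltr_pM2l//; lra.
have bm2 : b * (total (z1 t) - e) < b * total (z2 u) by rewrite ltr_pM2l//; lra.
by split; lra.
Qed.

Lemma solution_unique t : 0 <= t <= T -> forall k, z1 t k = z2 t k.
Proof.
move: t; apply: real_induction; first exact: agree_limit.
move=> t t0 tT before; apply: agree_extend => //.
by move=> k; apply: before; rewrite t0 lexx.
Qed.

End uniqueness.

(** * Proof of the theorem *)

Section modification.
Variables (R : realType) (T : R) (p : nat -> R).
Variables (zeta : R -> nat -> R) (psi : R -> R) (phi : nat -> R * R -> R).
Variable delta : R.
Hypothesis T_gt0 : 0 < T.
Hypothesis delta_gt0 : 0 < delta.
Hypothesis fmp : finite_mean p.
Hypothesis CT : in_CT T p zeta psi.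
Hypothesis sol : ST T p zeta psi phi.

Let r k := (fun t => rfrac (zeta t) k) \_ `[0, T].
Let f k := phi k \_ (strip T).

(** [r] and [f] are extended by [0] to all times and to the whole plane, where
    the dilation lemmas apply. *)
Definition gapped k := dilate_gap (1 + delta) (r k) (f k).

Let mr k : measurable_fun setT (r k).
Proof.
apply/(measurable_restrictT _ _).1 => //.
exact: path_rfrac_measurable CT fmp k.
Qed.

Let rE k t : 0 <= t <= T -> r k t = rfrac (zeta t) k.
Proof. by move=> tT; rewrite /r patchE mem_set//= in_itv. Qed.

Let r01 k t : 0 <= r k t <= 1.
Proof.
rewrite /r patchE; case: ifPn => [|_]; last by rewrite lexx ler01.
rewrite inE/= in_itv/= => tT; apply: rfrac_itv.
exact: (path_finite_mean CT fmp tT).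
Qed.

Let mf k : measurable_fun setT (f k).
Proof.
apply/(measurable_restrictT _ _).1; first exact: measurable_strip.
exact: ST_meas sol k.
Qed.

Let f0 k u : 0 <= f k u.
Proof.
by rewrite /f patchE; case: ifPn => // /[!inE] uT; exact: ST_ge0 sol k u uT.
Qed.

Let fE k u : strip T u -> f k u = phi k u.
Proof. by move=> uT; rewrite /f patchE mem_set. Qed.

Let d0 : 0 <= 1 + delta. Proof. by rewrite addr_ge0// ltW. Qed.

Lemma gapped_mass k t : 0 <= t <= T ->
  thinned_mass zeta (gapped) k t = thinned_mass zeta phi k t.
Proof.
move=> /andP[t0 tT].
have sub : strip t `<=` @strip R T by exact: strip_sub.
have u1 u : u \in strip t -> 0 <= u.1 <= T.
  by rewrite inE => /sub[+ _]; rewrite /= in_itv.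
have := @dilate_gap_mass _ (1 + delta) t (r k) (f k) _ (mr k) (r01 k)
  (mf k) (f0 k).
rewrite lerDl => /(_ (ltW delta_gt0)) h.
transitivity (\int[leb2 R]_(u in strip t)
     (\1_`[0%R, r k u.1[ u.2 * dilate_gap (1 + delta) (r k) (f k) u)%R%:E)%E.
  by apply: eq_integral => u ut; rewrite rE// u1.
rewrite h; apply: eq_integral => u ut; rewrite rE ?u1// fE//.
by apply: sub; rewrite inE in ut.
Qed.

Lemma gapped_solution : ST T p zeta psi gapped.
Proof.
split.
- by move=> k; apply: measurable_funTS; exact: measurable_dilate_gap.
- by move=> k u _; exact: dilate_gap_ge0.
- move=> t tT; rewrite (ST_psi sol tT).
  by apply: eq_eseriesr => k _; rewrite gapped_mass.
- by move=> t tT k k0; rewrite (ST_zeta sol tT k0) gapped_mass.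
Qed.

Lemma gapped_has_gap : has_gap (1 + delta) T zeta gapped.
Proof.
move=> k u [u1 _] /andP[ru ur].
have uT : 0 <= u.1 <= T by move: u1; rewrite /= in_itv.
by rewrite /gapped /dilate_gap rE// ltNge ru/= ur.
Qed.

Lemma gapped_cost : (cost T gapped <=
  (1 + delta)%:E * cost T phi + (delta * (expR 1 + 2) * T)%:E)%E.
Proof.
pose C k := (\int[leb2 R]_(u in strip T)
  (ell (phi k u))%:E)%E.
pose Q k := (\int[@lebesgue_measure R]_(s in `[0%R, T]) (r k s)%:E)%E.
have C0 k : (0 <= C k)%E.
  by apply: integral_ge0 => u uT; rewrite lee_fin ell_ge0// (ST_ge0 sol).
have Q0 k : (0 <= Q k)%E.
  by apply: integral_ge0 => s _; rewrite lee_fin; case/andP: (r01 k s).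
have K0 : 0 <= delta * (expR 1 + 2).
  by rewrite mulr_ge0 ?addr_ge0 ?expR_ge0// ltW.
have sumQ : (\sum_(0 <= k <oo) Q k <= T%:E)%E.
  rewrite /Q -integral_nneseries//; last 2 first.
  - by move=> k; apply/measurable_EFinP; exact: measurable_funTS (mr k).
  - by move=> k s _; rewrite lee_fin; case/andP: (r01 k s).
  apply: (@le_trans _ _
    (\int[@lebesgue_measure R]_(s in `[0%R, T]) (cst 1%E s))%E).
    apply: ge0_le_integral => //.
    - move=> s _; apply: nneseries_ge0 => k _ _.
      by rewrite lee_fin; case/andP: (r01 k s).
    - apply: (@ge0_emeasurable_sum _ _ _ _ (fun k s => (r k s)%:E) xpredT)
        => //.
        by move=> k s _ _; rewrite lee_fin; case/andP: (r01 k s).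
      by move=> k _; apply/measurable_EFinP; exact: measurable_funTS (mr k).
    - move=> s; rewrite /= in_itv/= => sT.
      under eq_eseriesr do rewrite rE//.
      exact/sum_rfrac_le1/(path_finite_mean CT fmp).
  rewrite integral_cst//= lebesgue_measure_itv/= lte_fin T_gt0.
  by rewrite mul1e oppr0 adde0.
apply: (@le_trans _ _ (\sum_(0 <= k <oo) ((1 + delta)%:E * C k +
    (delta * (expR 1 + 2))%:E * Q k))%E).
  apply: lee_nneseries => k _.
    move=> _; apply: integral_ge0 => u _; rewrite lee_fin ell_ge0//.
    exact: dilate_gap_ge0.
  have -> : C k = (\int[leb2 R]_(u in strip T)
      (ell (f k u))%:E)%E.
    by apply: eq_integral => u uT; rewrite fE//; rewrite inE in uT.
  exact: dilate_gap_cost.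
rewrite nneseriesD; last 2 first.
- by move=> k _ _; rewrite mule_ge0.
- by move=> k _ _; rewrite mule_ge0.
rewrite !nneseriesZl//; apply: leeD => //.
by rewrite [leRHS]EFinM lee_wpmul2l.
Qed.

End modification.

Theorem lemma6p1 (R : realType)
    (d : forall n : nat, 'I_n -> nat) (p : nat -> R) (T sigma : R)
    (d_pos : forall (n : nat) (i : 'I_n), (0 < d n i)%N)
    (d_even : forall n : nat, ~~ odd (\sum_(i < n) d n i)%N)
    (p_distr : is_distribution p)
    (d_cvg : degree_convergence d p)
    (d_moment : exists2 eps : R, 0 < eps & (degree_moment d eps < +oo)%E)
    (T_gt0 : 0 < T) (sigma_gt0 : 0 < sigma) (sigma_lt1 : sigma < 1)
    (zeta : R -> nat -> R) (psi : R -> R)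
    (zeta_psi_CT : in_CT T p zeta psi)
    (IT_fin : (IT T p zeta psi < +oo)%E) :
  exists phi : nat -> R * R -> R,
    [/\ ST T p zeta psi phi,
        (cost T phi <= IT T p zeta psi + sigma%:E)%E
      & forall (zeta' : R -> nat -> R) (psi' : R -> R),
          in_CT T p zeta' psi' -> ST T p zeta' psi' phi ->
          forall t : R, 0 <= t <= T ->
            (forall k, zeta' t k = zeta t k) /\ psi' t = psi t].
Proof.
have fmp : finite_mean p.
  have [eps eps0 mom] := d_moment.
  exact: finite_mean_limit eps0 mom d_cvg p_distr.
have IT0 : (0 <= IT T p zeta psi)%E.
  apply: le_ereal_inf_tmp => _ [phi sol <-].
  by apply: cost_ge0; exact: ST_ge0 sol.
have ITfin : IT T p zeta psi \is a fin_num by rewrite ge0_fin_numE.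
have sigma2 : 0 < sigma / 2 by rewrite divr_gt0.
have [_ [phi sol <-] costphi] := lb_ereal_inf_adherent sigma2 ITfin.
have phi_ge0 := cost_ge0 (ST_ge0 sol).
have phi_fin : cost T phi \is a fin_num.
  by rewrite ge0_fin_numE// (lt_le_trans costphi)// leey.
pose c := fine (cost T phi).
have cE : cost T phi = c%:E by rewrite /c fineK.
have c0 : 0 <= c by rewrite fine_ge0.
pose M := c + (expR 1 + 2) * T.
have M0 : 0 <= M by rewrite addr_ge0// mulr_ge0 ?addr_ge0 ?expR_ge0// ltW.
(* Half of [sigma] pays for the near optimality of [phi], half for the gap,
   which costs [delta * M]. *)
pose delta := sigma / 2 / (M + 1).
have delta0 : 0 < delta by rewrite divr_gt0// ltr_wpDl.
have deltaM : delta * M <= sigma / 2.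
  rewrite /delta mulrAC ler_pdivrMr ?ltr_wpDl//.
  by rewrite ler_wpM2l ?(ltW sigma2)// lerDl.
have cost_le :
    (cost T (gapped T zeta phi delta) <= IT T p zeta psi + sigma%:E)%E.
  apply: (le_trans (gapped_cost T_gt0 delta0 fmp zeta_psi_CT sol)).
  have {}costphi : (c%:E < IT T p zeta psi + (sigma / 2)%:E)%E by rewrite -cE.
  rewrite -(fineK ITfin) -EFinD lte_fin in costphi.
  rewrite cE -(fineK ITfin) -EFinM -!EFinD lee_fin.
  move: deltaM; rewrite /M; lra.
have sol' := gapped_solution delta0 fmp zeta_psi_CT sol.
exists (gapped T zeta phi delta); split => // zeta' psi' CT' ST'.
have fin' : (cost T (gapped T zeta phi delta) < +oo)%E.
  by apply: (le_lt_trans cost_le); rewrite -(fineK ITfin) -EFinD ltry.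
have delta1 : 1 < 1 + delta by rewrite ltrDl.
have zz := solution_unique delta1 fmp fin' zeta_psi_CT CT'
  sol' ST' (@gapped_has_gap _ _ _ _ _).
move=> t tT; split => [k|]; first by rewrite zz.
apply: EFin_inj; rewrite (ST_psi ST' tT) (ST_psi sol' tT).
apply: eq_eseriesr => k _; congr (_ * _)%E; apply: eq_integral => u.
rewrite inE => -[+ _]; rewrite /= in_itv/= => /andP[u0 ut].
rewrite (_ : zeta' u.1 = zeta u.1)//; apply/funext => j; rewrite zz// u0.
by rewrite (le_trans ut)//; case/andP: tT.
Qed.
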